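(* Let $X$ be the self-adjoint multiplication operator $Xf(x)=x\,f(x)$ on $L^2(\mathbb{R},\mathbb{C})$ and let $T=\sqrt{2}\,X$, which is an $\mathcal{N}(0,1)$-distributed quantum random variable in the state $\Phi(x)=\pi^{-1/4}e^{-x^2/2}$. Then for $t\in\mathbb{R}$ the characteristic function of $T^3$ is $$\langle e^{itT^3}\rangle=\begin{cases}\dfrac{1}{3|t|\sqrt{6\pi}}\,e^{\frac{1}{108t^2}}\,K_{1/3}\!\left(\dfrac{1}{108t^2}\right), & \text{if } t\neq 0,\\[2mm] 1, & \text{if } t=0,\end{cases}$$ where $K_\nu(z)$ denotes the modified Bessel function of the second kind.
   Context: $L^2(\mathbb{R},\mathbb{C})$ carries the inner product $\langle f,g\rangle=\int_{\mathbb{R}}\overline{f(x)}g(x)\,dx$. The unbounded self-adjoint operator $X$, $Xf(x)=x f(x)$, has domain $\{f\in L^2(\mathbb{R},\mathbb{C}):\int_{\mathbb{R}}x^2|f(x)|^2\,dx<\infty\}$. The function $\Phi(x)=\pi^{-1/4}e^{-x^2/2}$ is a unit vector in $L^2(\mathbb{R},\mathbb{C})$. For a self-adjoint operator $A$ on $L^2(\mathbb{R},\mathbb{C})$, its characteristic function (in the state $\Phi$) is $\langle e^{itA}\rangle=\langle\Phi,e^{itA}\Phi\rangle$, $t\in\mathbb{R}$; via Bochner's theorem, $A$ is identified with the classical random variable having this characteristic function. The operators $T^3$ and $e^{itT^3}$ are defined by the spectral theorem (functional calculus). One has $\langle e^{itT}\rangle=e^{-t^2/2}$, i.e. $T\sim\mathcal{N}(0,1)$,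 where $\mathcal{N}(\mu,\sigma^2)$ is the Gaussian distribution with mean $\mu$ and variance $\sigma^2$. *)

(* Defs.v *)
From HB Require Import structures.
From mathcomp Require Import all_boot all_order all_algebra.
From mathcomp Require Import generic_quotient ring_quotient complex.
From mathcomp Require Import all_classical all_reals all_analysis.
From mathcomp Require Import measurable_realfun.
From mathcomp Require Import ring lra.

Set Implicit Arguments.
Unset Strict Implicit.
Unset Printing Implicit Defensive.

Import Order.TTheory GRing.Theory Num.Theory.
Import numFieldNormedType.Exports.
Import Normc.

Local Open Scope classical_set_scope.
Local Open Scope ring_scope.
Local Open Scope complex_scope.

(** * The Hilbert space L^2(R, C) *)

Section square_integrable.
Context {R : realType}.
Local Notation C := R[i].
Local Notation mu := (@lebesgue_measure R).

Lemma sqr_normc (z : C) : normc z ^+ 2 = complex.Re z ^+ 2 + complex.Im z ^+ 2.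
Proof. by case: z => a b /=; rewrite sqr_sqrtr// addr_ge0// sqr_ge0. Qed.

(* R[i] carries no measurable structure: measurability is stated for the real
   and imaginary parts. *)
Definition square_integrable (f : R -> C) : Prop :=
  [/\ measurable_fun setT (fun x => complex.Re (f x)),
      measurable_fun setT (fun x => complex.Im (f x))
    & (\int[mu]_x (normc (f x) ^+ 2)%:E < +oo)%E].

Definition sqint : {pred R -> C} := fun f => `[< square_integrable f >].

Lemma measurable_sqr_normc (f : R -> C) :
  measurable_fun setT (fun x => complex.Re (f x)) ->
  measurable_fun setT (fun x => complex.Im (f x)) ->
  measurable_fun setT (fun x => (normc (f x) ^+ 2)%:E : \bar R).
Proof.
move=> mr mi; apply/measurable_EFinP.
under eq_fun do rewrite sqr_normc.
by apply: measurable_funD; exact: measurable_funX.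
Qed.

Lemma normc_lin_le (a z w : C) :
  normc (a * z + w) ^+ 2 <=
    2 * normc a ^+ 2 * normc z ^+ 2 + 2 * normc w ^+ 2.
Proof.
rewrite !sqr_normc; case: a z w => [a b] [c d] [e f] /=.
have := sqr_ge0 (a * c - b * d - e); have := sqr_ge0 (a * d + b * c - f).
by nra.
Qed.

Lemma sqint_submod_closed : submod_closed sqint.
Proof.
split.
  apply/asboolP; split; [exact: measurable_cst|exact: measurable_cst|].
  by under eq_integral do rewrite normc0 expr0n; rewrite integral0.
move=> a f g /asboolP[fr fi f2] /asboolP[gr gi g2].
have hr : measurable_fun setT (fun x => complex.Re ((a *: f + g) x)).
  rewrite [X in measurable_fun _ X](_ : _ = fun x =>
    complex.Re a * complex.Re (f x) - complex.Im a * complex.Im (f x)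
    + complex.Re (g x)); last first.
    apply/funext => x; rewrite -[(_ + _) x]/(a * f x + g x).
    by move: a (f x) (g x) => [a b] [c d] [e k].
  apply: measurable_funD => //; apply: measurable_funB;
    exact: measurable_funM.
have hi : measurable_fun setT (fun x => complex.Im ((a *: f + g) x)).
  rewrite [X in measurable_fun _ X](_ : _ = fun x =>
    complex.Re a * complex.Im (f x) + complex.Im a * complex.Re (f x)
    + complex.Im (g x)); last first.
    apply/funext => x; rewrite -[(_ + _) x]/(a * f x + g x).
    by clear hr; move: a (f x) (g x) => [a b] [c d] [e k].
  apply: measurable_funD => //; apply: measurable_funD;
    exact: measurable_funM.
apply/asboolP; split => //.
have mf := measurable_sqr_normc fr fi.
have mg := measurable_sqr_normc gr gi.
have mh := measurable_sqr_normc hr hi.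
have ge0 (u : R -> C) x : setT x -> (0 <= (normc (u x) ^+ 2)%:E)%E.
  by rewrite lee_fin sqr_ge0.
pose k := 2 * normc a ^+ 2.
have k0 : 0 <= k by rewrite mulr_ge0// sqr_ge0.
apply: (@le_lt_trans _ _ (\int[mu]_x
  (k%:E * (normc (f x) ^+ 2)%:E + 2%:E * (normc (g x) ^+ 2)%:E))%E).
  apply: ge0_le_integral => //.
  - exact: ge0.
  - by apply: emeasurable_funD; exact: measurable_funeM.
  - move=> x _; rewrite -!EFinM -EFinD lee_fin.
    exact: normc_lin_le.
rewrite ge0_integralD//.
- rewrite !ge0_integralZl//; last 2 first.
  + by move=> x _; exact: ge0.
  + by move=> x _; exact: ge0.
  by apply: lte_add_pinfty; apply: lte_mul_pinfty.
- by move=> x _; rewrite mule_ge0// ?lee_fin//; exact: ge0.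
- exact: measurable_funeM.
- by move=> x _; rewrite mule_ge0// ?lee_fin//; exact: ge0.
- exact: measurable_funeM.
Qed.

HB.instance Definition _ :=
  GRing.isSubmodClosed.Build C (R -> C) sqint sqint_submod_closed.

End square_integrable.

Section L2.
Context (R : realType).
Local Notation C := R[i].
Local Notation mu := (@lebesgue_measure R).

Record sqfun := SqFun { sqfun_val :> R -> C ; _ : sqfun_val \in @sqint R }.
HB.instance Definition _ := [isSub for sqfun_val].
HB.instance Definition _ := [Choice of sqfun by <:].
HB.instance Definition _ := [SubChoice_isSubLmodule of sqfun by <:].

Definition ae_zero : {pred sqfun} :=
  fun f => `[< {ae mu, forall x, f x = 0} >].

Lemma ae_zero_submod_closed : submod_closed ae_zero.
Proof.
have ? : Filter (almost_everywhere mu) by exact: ae_filter_ringOfSetsType.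
split; first by apply/asboolP; apply: aeW.
move=> a f g /asboolP f0 /asboolP g0; apply/asboolP.
apply: (filterS2 _ _ f0 g0) => x fx gx.
by rewrite -[LHS]/(a * f x + g x) fx gx mulr0 addr0.
Qed.

HB.instance Definition _ :=
  GRing.isSubmodClosed.Build C sqfun ae_zero ae_zero_submod_closed.

Local Open Scope quotient_scope.

Definition L2 : Type := Quotient.quot ae_zero.
HB.instance Definition _ := GRing.Zmodule.on L2.
HB.instance Definition _ := EqQuotient.on L2.

Definition L2_scale (a : C) (u : L2) : L2 := \pi_L2 (a *: repr u).

Lemma L2_piP (f g : sqfun) : \pi_L2 f = \pi_L2 g <-> f - g \in ae_zero.
Proof.
by rewrite Quotient.idealrBE; split => [h|/eqP]; [apply/eqP; exact: h|exact].
Qed.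

Lemma L2_piD (f g : sqfun) : \pi_L2 (f + g) = \pi_L2 f + \pi_L2 g.
Proof. exact: Quotient.pi_add. Qed.

Lemma L2_pi_scale a (f : sqfun) : \pi_L2 (a *: f) = L2_scale a (\pi_L2 f).
Proof.
by apply/L2_piP; rewrite -scalerBr rpredZ//; apply/L2_piP; rewrite reprK.
Qed.

Let L2_scaleA a b u : L2_scale a (L2_scale b u) = L2_scale (a * b) u.
Proof.
elim/quotW: u => f.
by rewrite -(L2_pi_scale b f) -(L2_pi_scale a) -(L2_pi_scale _ f) scalerA.
Qed.

Let L2_scale1 : left_id 1 L2_scale.
Proof. by elim/quotW=> f; rewrite -(L2_pi_scale 1 f) scale1r. Qed.

Let L2_scaleDr : right_distributive L2_scale +%R.
Proof.
move=> a; elim/quotW=> f; elim/quotW=> g.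
rewrite -(L2_piD f g) -(L2_pi_scale a (f + g)) scalerDr L2_piD.
by rewrite (L2_pi_scale a f) (L2_pi_scale a g).
Qed.

Let L2_scaleDl u : {morph L2_scale^~ u : a b / a + b}.
Proof.
elim/quotW: u => f a b.
by rewrite -(L2_pi_scale _ f) scalerDl L2_piD !(L2_pi_scale _ f).
Qed.

HB.instance Definition _ := GRing.Zmodule_isLmodule.Build C L2
  L2_scaleA L2_scale1 L2_scaleDr L2_scaleDl.

(* The class of [f]; it is 0 when [f] is not square integrable. *)
Definition L2_class (f : R -> C) : L2 := \pi_L2 (insubd (0 : sqfun) f).

Definition cintegral (m : set (measurableTypeR R) -> \bar R) (f : R -> C) : C :=
  fine (\int[m]_x (complex.Re (f x))%:E) +i*
  fine (\int[m]_x (complex.Im (f x))%:E).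

Definition inner (u v : L2) : C :=
  cintegral mu (fun x => conjc (repr u x) * repr v x).

End L2.

(** * Unbounded operators and the Borel functional calculus *)

Section operators.
Context (R : realType).
Local Notation C := R[i].
Local Notation H := (L2 R).
Local Notation mu := (@lebesgue_measure R).

(* A partially defined operator: only the values of [act] on [dom] are
   meaningful. *)
Record operator := Operator { dom : set H ; act : H -> H }.
HB.instance Definition _ := gen_eqMixin operator.
HB.instance Definition _ := gen_choiceMixin operator.

Definition scale_op (c : C) (A : operator) : operator :=
  Operator (dom A) (fun u => c *: act A u).

Definition linear_on (A : operator) : Prop :=
  forall (c : C) u v, dom A u -> dom A v ->
    dom A (c *: u + v) /\ act A (c *: u + v) = c *: act A u + act A v.

Definition orthogonal_projection (P : H -> H) : Prop :=
  [/\ linear P, forall u, P (P u) = P u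
    & forall u v, inner (P u) v = inner u (P v)].

Implicit Types (E : set (measurableTypeR R) -> H -> H) (phi : R -> C).

(* B |-> <u, E(B) u>, which is real and nonnegative. *)
Definition spectral_mass E (u : H) (B : set (measurableTypeR R)) : \bar R :=
  (complex.Re (inner u (E B u)))%:E.

Definition projection_valued_measure E : Prop :=
  [/\ forall B, measurable B -> orthogonal_projection (E B),
      E set0 = cst 0, E setT = id,
      forall A B, measurable A -> measurable B -> E (A `&` B) = E A \o E B
    & forall u, semi_sigma_additive (spectral_mass E u)].

(* A is the integral of phi with respect to E: its domain consists of the u
   with |phi|^2 integrable for <u, E(.) u>, and <u, A u> is the integral of phi
   for <u, E(.) u>. By polarization the quadratic form determines the linear
   operator A. *)
Definition spectral_integral E phi (A : operator) : Prop :=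
  [/\ dom A = [set u | (\int[spectral_mass E u]_x
                          (normc (phi x) ^+ 2)%:E < +oo)%E],
      linear_on A
    & forall u, dom A u ->
        inner u (act A u) = cintegral (spectral_mass E u) phi].

(* [E] is the spectral measure of [A]. *)
Definition spectral_measure (A : operator) E : Prop :=
  projection_valued_measure E /\ spectral_integral E (real_complex R) A.

(* The operator phi(A), phi a Borel function; the default value is taken only
   when A has no spectral measure, i.e. when A is not self-adjoint. *)
Definition functional_calculus phi (A : operator) : operator :=
  xget (Operator set0 id)
    [set B | exists E, spectral_measure A E /\ spectral_integral E phi B].

Definition expi (x : R) : C := cos x +i* sin x.

Definition op_cube (A : operator) : operator :=
  functional_calculus (fun x => (x ^+ 3)%:C) A.

Definition op_expi (t : R) (A : operator) : operator :=
  functional_calculus (fun x => expi (t * x)) A.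

(* <e^{itA}> in the state u. *)
Definition char_fun (u : H) (A : operator) (t : R) : C :=
  inner u (act (op_expi t A) u).

(* A is identified with a classical random variable of law P. *)
Definition has_law (u : H) (A : operator)
    (P : set (measurableTypeR R) -> \bar R) : Prop :=
  forall t, char_fun u A t = cintegral P (fun x => expi (t * x)).

Definition position : operator :=
  Operator [set u : H | (\int[mu]_x (x ^+ 2 * normc (repr u x) ^+ 2)%:E < +oo)%E]
    (fun u => L2_class (fun x => x%:C * repr u x)).

Definition opT : operator := scale_op (Num.sqrt 2)%:C position.

Definition Phi : H :=
  L2_class (fun x => (pi `^ (- 4^-1) * expR (- (x ^+ 2 / 2)))%:C).

Definition cosh (x : R) : R := (expR x + expR (- x)) / 2.

(* The modified Bessel function of the second kind, z > 0, defined by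
   K_nu(z) = \int_0^oo e^{-z cosh u} cosh (nu u) du. *)
Definition besselK (nu z : R) : R :=
  \int[mu]_(u in `[0, +oo[) (expR (- z * cosh u) * cosh (nu * u)).

End operators.

(* Main.v *)
Require Import Defs.
From HB Require Import structures.
From mathcomp Require Import all_boot all_order all_algebra complex.
From mathcomp Require Import all_classical all_reals all_analysis.
From mathcomp Require Import measurable_realfun.
From mathcomp Require Import ring lra.

Set Implicit Arguments.
Unset Strict Implicit.
Unset Printing Implicit Defensive.

Import Order.TTheory GRing.Theory Num.Theory.
Import numFieldNormedType.Exports.
Import Normc.

Local Open Scope classical_set_scope.
Local Open Scope ring_scope.
Local Open Scope complex_scope.

(** The proof has a spectral half and an analytic half.

    Spectral half. [X] acts as multiplication by [x], so [T] acts as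
    multiplication by [sqrt 2 * x], and one expects [psi(T)] to be
    multiplication by [psi (sqrt 2 * x)]. Multiplication by indicator functions
    does give a spectral measure of [T] ([mult_pvm_projection_valued]), but the
    functional calculus may use any other one, so that uniqueness of the
    spectral measure [E] of the operator [A] of multiplication by a function
    [phi] is required. It follows from comparing quadratic forms. The form of
    [A] is additive over the ranges of two complementary projections, hence by
    polarization [A] commutes with [E] ([spectral_offdiag],
    [spectral_commute]); on the range of the projection [E B] for the half line
    [B] below [b] the form is at most [b], on the complementary range at least
    [b]. The vectors in the range of a projection commuting with multiplication
    by [y] vanish where [y > 0] if the form of [y] is nonpositive on this range
    ([negative_part_vanish]). With [y = phi - b] and [y = b - phi] this
    identifies [E B] with multiplication by the indicator of [phi < b]
    ([spectral_half_line]), and half lines generate the Borel sets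
    ([spectral_measure_mult], [functional_calculus_mult]). Since [|Phi|^2] is
    the density of a centred Gaussian of variance 1/2 ([ground_state_law]), the
    characteristic functions of [T] and [T^3] are the expectations of
    [e^{itZ}] and [e^{itZ^3}] for a standard Gaussian [Z].

    Analytic half. The imaginary part of the expectation of [e^{itZ^3}]
    vanishes by oddness and its real part depends on [|t|] only, so let
    [t > 0]. The exponent [i t z^3 - z^2 / 2] has a saddle point at 0; its path
    of steepest descent is [x + i Y x] with [t x^2 = 3 t (Y x)^2 + Y x], and
    moving the line of integration to this path is legitimate because the
    integrand has Gaussian decay between the two ([contour_deformation]). With
    [S = sqrt (1 + 12 t^2 x^2)] and [z = 1 / (108 t^2)], the exponent on the
    path is the real number [z - z (4 S^3 - 3 S)]. As
    [4 cosh^3 a - 3 cosh a = cosh (3 a)], the substitution [S = cosh (v / 3)]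
    turns the integral into the one defining [K_{1/3} (z)]
    ([besselK_substitution], [cubic_gauss_integral]). *)

(** * Complex valued functions and their integrals *)

Section almost_everywhere.
Context {R : realType}.
Local Notation TR := (measurableTypeR R).
Implicit Types m : {measure set TR -> \bar R}.

Lemma ae_mp m (P Q : R -> Prop) : (forall x, P x -> Q x) ->
  {ae m, forall x, P x} -> {ae m, forall x, Q x}.
Proof.
move=> PQ; have ? : Filter (almost_everywhere m) by exact: ae_filter_ringOfSetsType.
exact: filterS.
Qed.

Lemma ae_mp2 m (P Q S : R -> Prop) : (forall x, P x -> Q x -> S x) ->
  {ae m, forall x, P x} -> {ae m, forall x, Q x} -> {ae m, forall x, S x}.
Proof.
move=> PQ; have ? : Filter (almost_everywhere m) by exact: ae_filter_ringOfSetsType.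
exact: filterS2.
Qed.

End almost_everywhere.

Section complex_functions.
Context {R : realType}.
Local Notation C := R[i].
Local Notation TR := (measurableTypeR R).
Local Notation mu := (@lebesgue_measure R).
Implicit Types (f g : R -> C).

Definition cmeasurable f : Prop :=
  measurable_fun [set: TR] (fun x => complex.Re (f x)) /\
  measurable_fun [set: TR] (fun x => complex.Im (f x)).

Definition cintegrable (m : {measure set TR -> \bar R}) f : Prop :=
  m.-integrable setT (fun x => (complex.Re (f x))%:E) /\
  m.-integrable setT (fun x => (complex.Im (f x))%:E).

Lemma cReD (z w : C) : complex.Re (z + w) = complex.Re z + complex.Re w.
Proof. by case: z w => [a b] [c d]. Qed.
Lemma cImD (z w : C) : complex.Im (z + w) = complex.Im z + complex.Im w.
Proof. by case: z w => [a b] [c d]. Qed.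
Lemma cReM (z w : C) : complex.Re (z * w) =
  complex.Re z * complex.Re w - complex.Im z * complex.Im w.
Proof. by case: z w => [a b] [c d]. Qed.
Lemma cImM (z w : C) : complex.Im (z * w) =
  complex.Re z * complex.Im w + complex.Im z * complex.Re w.
Proof. by case: z w => [a b] [c d]. Qed.
Lemma cReJ (z : C) : complex.Re (conjc z) = complex.Re z.
Proof. by case: z. Qed.
Lemma cImJ (z : C) : complex.Im (conjc z) = - complex.Im z.
Proof. by case: z. Qed.
Lemma conjcD (z w : C) : conjc (z + w) = conjc z + conjc w.
Proof. by rewrite rmorphD. Qed.
Lemma conjcM (z w : C) : conjc (z * w) = conjc z * conjc w.
Proof. by rewrite rmorphM. Qed.
Lemma conjcN (z : C) : conjc (- z) = - conjc z.
Proof. by rewrite rmorphN. Qed.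
Lemma complexP (z w : C) : complex.Re z = complex.Re w ->
  complex.Im z = complex.Im w -> z = w.
Proof. by case: z w => [a b] [c d] /= -> ->. Qed.

(** Separates the linear from the antilinear part, by [c = 1] and [c = i]; this
    is how polarization identities are exploited below. *)
Lemma sesquilinear_eq0 (z w : C) :
  (forall c : C, c * z + conjc c * w = 0) -> z = 0 /\ w = 0.
Proof.
move=> h; have := h 1; have := h 'i.
rewrite conjc1 !mul1r; move: z w {h} => [a b] [c d] [h1 h2] [h3 h4].
move: h1 h2 h3 h4; rewrite !mul0r !mul1r !add0r ?mulN1r ?sub0r ?subr0 ?addr0.
by move=> h1 h2 h3 h4; split; apply: complexP => /=; lra.
Qed.

Lemma mulJc (z : C) : conjc z * z = (normc z ^+ 2)%:C.
Proof.
by case: z => a b; rewrite Defs.sqr_normc; apply: complexP => /=; ring.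
Qed.

Lemma cmeasurable_cst (c : C) : cmeasurable (fun=> c).
Proof. by split; exact: measurable_cst. Qed.

Lemma cmeasurable_real (h : R -> R) : measurable_fun [set: TR] h ->
  cmeasurable (fun x => (h x)%:C).
Proof. by move=> mh; split => //=; exact: measurable_cst. Qed.

Lemma cmeasurableD f g : cmeasurable f -> cmeasurable g ->
  cmeasurable (fun x => f x + g x).
Proof.
move=> [fr fi] [gr gi]; split.
  by under eq_fun do rewrite cReD; exact: measurable_funD.
by under eq_fun do rewrite cImD; exact: measurable_funD.
Qed.

Lemma cmeasurableM f g : cmeasurable f -> cmeasurable g ->
  cmeasurable (fun x => f x * g x).
Proof.
move=> [fr fi] [gr gi]; split.
  under eq_fun do rewrite cReM.
  by apply: measurable_funB; exact: measurable_funM.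
under eq_fun do rewrite cImM.
by apply: measurable_funD; exact: measurable_funM.
Qed.

Lemma cmeasurableJ f : cmeasurable f -> cmeasurable (fun x => conjc (f x)).
Proof.
move=> [fr fi]; split; first by under eq_fun do rewrite cReJ.
by under eq_fun do rewrite cImJ; exact: measurableT_comp.
Qed.

Lemma cmeasurable_comp (h : R -> R) f : cmeasurable f ->
  measurable_fun [set: TR] (h : TR -> TR) -> cmeasurable (fun x => f (h x)).
Proof.
move=> [fr fi] mh; split.
  exact: (measurableT_comp fr mh).
exact: (measurableT_comp fi mh).
Qed.

Lemma measurable_inv1D (h : R -> R) : measurable_fun [set: TR] h ->
  (forall x, 0 <= h x) -> measurable_fun [set: TR] (fun x => (1 + h x)^-1).
Proof.
move=> mh h0; rewrite [X in measurable_fun _ X](_ : _ = fun x => (1 + h x) `^ (-1)).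
  apply: (measurableT_comp (measurable_powR _)).
  by apply: measurable_funD.
by apply/funext => x; rewrite powR_inv1// addr_ge0.
Qed.

Lemma measurable_Enormc2 f : cmeasurable f ->
  measurable_fun [set: TR] (fun x => (normc (f x) ^+ 2)%:E).
Proof. by move=> [fr fi]; exact: measurable_sqr_normc. Qed.

Lemma measurable_normc2 f : cmeasurable f ->
  measurable_fun [set: TR] (fun x => normc (f x) ^+ 2).
Proof.
move=> [fr fi]; under eq_fun do rewrite Defs.sqr_normc.
by apply: measurable_funD; exact: measurable_funX.
Qed.

Section integral.
Variable m : {measure set TR -> \bar R}.

Lemma cintegralD f g : cintegrable m f -> cintegrable m g ->
  cintegral m (fun x => f x + g x) = cintegral m f + cintegral m g.
Proof.
move=> [fr fi] [gr gi]; apply: complexP; rewrite ?cReD ?cImD /cintegral /=.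
  under eq_integral do rewrite cReD.
  exact: (@RintegralD _ _ _ m setT).
under eq_integral do rewrite cImD.
exact: (@RintegralD _ _ _ m setT).
Qed.

Lemma cintegrableZ (c : C) f : cintegrable m f -> cintegrable m (fun x => c * f x).
Proof.
move=> [fr fi]; split.
  under eq_fun do rewrite cReM EFinB !EFinM.
  by apply: integrableB => //; exact: integrableZl.
under eq_fun do rewrite cImM EFinD !EFinM.
by apply: integrableD => //; exact: integrableZl.
Qed.

Lemma cintegralZ (c : C) f : cintegrable m f ->
  cintegral m (fun x => c * f x) = c * cintegral m f.
Proof.
move=> [fr fi]; have iZ (k : R) (h : R -> R) :
    m.-integrable setT (EFin \o h) -> m.-integrable setT (EFin \o (fun x => k * h x)).
  by move=> ih; exact: (@integrableZl _ _ _ m setT measurableT k _ ih).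
apply: complexP; rewrite ?cReM ?cImM /cintegral /=.
  under eq_integral do rewrite cReM.
  have := @RintegralB _ _ _ m setT _ _ measurableT (iZ (complex.Re c) _ fr)
    (iZ (complex.Im c) _ fi).
  by rewrite {1}/Rintegral /= => ->; congr (_ - _); exact: RintegralZl.
under eq_integral do rewrite cImM.
have := @RintegralD _ _ _ m setT _ _ measurableT (iZ (complex.Re c) _ fi)
    (iZ (complex.Im c) _ fr).
by rewrite {1}/Rintegral /= => ->; congr (_ + _); exact: RintegralZl.
Qed.

Lemma cintegralJ f : cintegrable m f ->
  cintegral m (fun x => conjc (f x)) = conjc (cintegral m f).
Proof.
move=> [fr fi]; rewrite /cintegral /=; congr (_ +i* _).
  by under eq_integral do rewrite cReJ.
under eq_integral do rewrite cImJ -(mulN1r (complex.Im _)).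
by rewrite -(mulN1r (fine _)); exact: (@RintegralZl _ _ _ m setT).
Qed.

Lemma ae_eq_cintegral f g : cmeasurable f -> cmeasurable g ->
  {ae m, forall x, f x = g x} -> cintegral m f = cintegral m g.
Proof.
move=> [fr fi] [gr gi] fg; rewrite /cintegral; congr (fine _ +i* fine _).
  apply: ae_eq_integral => //; try exact/measurable_EFinP.
  by apply: ae_mp fg => x ->.
apply: ae_eq_integral => //; try exact/measurable_EFinP.
by apply: ae_mp fg => x ->.
Qed.

Lemma eq_cintegral f g : f =1 g -> cintegral m f = cintegral m g.
Proof. by move=> /funext ->. Qed.

End integral.

Lemma sqintP f : square_integrable f <->
  cmeasurable f /\ (\int[mu]_x (normc (f x) ^+ 2)%:E < +oo)%E.
Proof. by split=> [[? ? ?]|[[? ?] ?]]; split. Qed.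

Lemma sqint_le f g : cmeasurable f -> square_integrable g ->
  (forall x, normc (f x) ^+ 2 <= normc (g x) ^+ 2) -> square_integrable f.
Proof.
move=> mf /sqintP[mg ig] fg; apply/sqintP; split => //.
apply: le_lt_trans ig; apply: ge0_le_integral => //.
- by move=> x _; rewrite lee_fin sqr_ge0.
- exact: measurable_Enormc2.
- exact: measurable_Enormc2.
- by move=> x _; rewrite lee_fin.
Qed.

Lemma sqint_lin (c : C) f g : square_integrable f -> square_integrable g ->
  square_integrable (fun x => c * f x + g x).
Proof.
move=> hf hg; have [_ H] := @sqint_submod_closed R.
by have /asboolP := H c f g (introT (asboolP _) hf) (introT (asboolP _) hg).
Qed.

Lemma sqint0 : square_integrable (fun=> 0 : C).
Proof. by have [/asboolP H _] := @sqint_submod_closed R. Qed.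

Lemma sqintZ (c : C) f : square_integrable f ->
  square_integrable (fun x => c * f x).
Proof.
move=> hf; have := sqint_lin c hf sqint0.
by under eq_fun do rewrite addr0.
Qed.

Lemma normcJ_sq (z : C) : normc (conjc z) ^+ 2 = normc z ^+ 2.
Proof. by rewrite !Defs.sqr_normc cReJ cImJ sqrrN. Qed.

Lemma sqintJ f : square_integrable f -> square_integrable (fun x => conjc (f x)).
Proof.
move=> hf; apply: sqint_le (hf) _; first by apply: cmeasurableJ; case/sqintP: hf.
by move=> x; rewrite normcJ_sq.
Qed.

Lemma sqint_ae f g : cmeasurable g -> {ae mu, forall x, f x = g x} ->
  square_integrable f -> square_integrable g.
Proof.
move=> mg fg /sqintP[mf fi]; apply/sqintP; split => //.
rewrite -(@ge0_ae_eq_integral _ _ _ mu setT (fun x => (normc (f x) ^+ 2)%:E)) //.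
- exact: measurable_Enormc2.
- exact: measurable_Enormc2.
- by move=> x _; rewrite lee_fin sqr_ge0.
- by move=> x _; rewrite lee_fin sqr_ge0.
- by apply: ae_mp fg => x ->.
Qed.

Lemma sqint_mul f g : square_integrable f -> square_integrable g ->
  cintegrable mu (fun x => f x * g x).
Proof.
move=> /sqintP[mf fi] /sqintP[mg gi]; have [mr mi] := cmeasurableM mf mg.
have key (h : R -> R) : measurable_fun [set: TR] h ->
    (forall x, `|h x| <= normc (f x) ^+ 2 + normc (g x) ^+ 2) ->
    mu.-integrable setT (fun x => (h x)%:E).
  move=> mh hb; apply: (@le_integrable _ _ _ mu _ measurableT _
      (fun x => (normc (f x) ^+ 2)%:E + (normc (g x) ^+ 2)%:E)%E).
  - exact/measurable_EFinP.
  - move=> x _ /=; rewrite lee_fin.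
    exact: (le_trans (hb x) (ler_norm _)).
  - apply: integrableD => //; apply/integrableP; split.
    + exact: measurable_Enormc2.
    + by under eq_integral do rewrite gee0_abs ?lee_fin ?sqr_ge0//.
    + exact: measurable_Enormc2.
    + by under eq_integral do rewrite gee0_abs ?lee_fin ?sqr_ge0//.
split; apply: key => // x; rewrite ?cReM ?cImM !Defs.sqr_normc ler_norml.
  move: (complex.Re (f x)) (complex.Im (f x)) (complex.Re (g x)) (complex.Im (g x)).
  move=> a b c d; apply/andP; split.
    have := sqr_ge0 (a + c); have := sqr_ge0 (b - d).
    have := sqr_ge0 a; have := sqr_ge0 b; have := sqr_ge0 c; have := sqr_ge0 d; nra.
  have := sqr_ge0 (a - c); have := sqr_ge0 (b + d).
  have := sqr_ge0 a; have := sqr_ge0 b; have := sqr_ge0 c; have := sqr_ge0 d; nra.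
move: (complex.Re (f x)) (complex.Im (f x)) (complex.Re (g x)) (complex.Im (g x)).
move=> a b c d; apply/andP; split.
  have := sqr_ge0 (a + d); have := sqr_ge0 (b + c).
  have := sqr_ge0 a; have := sqr_ge0 b; have := sqr_ge0 c; have := sqr_ge0 d; nra.
have := sqr_ge0 (a - d); have := sqr_ge0 (b - c).
have := sqr_ge0 a; have := sqr_ge0 b; have := sqr_ge0 c; have := sqr_ge0 d; nra.
Qed.

End complex_functions.

(** * Integrals against set functions and change of variables *)

Section measures.
Import HBNNSimple.
Context {R : realType}.
Local Notation C := R[i].
Local Notation TR := (measurableTypeR R).
Local Notation mu := (@lebesgue_measure R).
Local Open Scope ereal_scope.

Section measure_of.
Variable s : set TR -> \bar R.
Hypothesis s0 : s set0 = 0.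
Hypothesis s_ge0 : forall B, measurable B -> 0 <= s B.
Hypothesis s_sigma : semi_sigma_additive s.
Hypothesis sT : s setT < +oo.

Let s' (B : set TR) : \bar R := if `[< measurable B >] then s B else 0.

Let s'E B : measurable B -> s' B = s B.
Proof. by move=> mB; rewrite /s' asboolT. Qed.

Let s'0 : s' set0 = 0. Proof. by rewrite s'E. Qed.

Let s'_ge0 B : 0 <= s' B.
Proof. by rewrite /s'; case: asboolP => // mB; exact: s_ge0. Qed.

Let s'_sigma : semi_sigma_additive s'.
Proof.
move=> F mF tF mUF; rewrite s'E//; under eq_fun do under eq_bigr do rewrite s'E//.
exact: s_sigma.
Qed.

HB.instance Definition _ := isMeasure.Build _ _ _ s' s'0 s'_ge0 s'_sigma.

Let s'_fin : fin_num_fun s'.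
Proof.
move=> B mB; rewrite ge0_fin_numE//.
apply: (@le_lt_trans _ _ (s' setT)); last by rewrite s'E.
by apply: le_measure; rewrite ?inE.
Qed.

HB.instance Definition _ := Measure_isFinite.Build _ _ _ s' s'_fin.

(** Spectral masses behave like measures on measurable sets, but nothing is
    known elsewhere; the witness is their extension by 0. *)
Lemma finite_measure_of : exists m : {finite_measure set TR -> \bar R},
  forall B, measurable B -> m B = s B.
Proof. by exists s'. Qed.

End measure_of.

(** Simple functions only charge measurable sets: spectral masses and laws,
    which are bare set functions, can be replaced by measures under the
    integral. *)
Lemma eq_setfun_integral (s : set TR -> \bar R)
    (m : {measure set TR -> \bar R}) (f : TR -> \bar R) :
  (forall B, measurable B -> m B = s B) -> \int[s]_x f x = \int[m]_x f x.
Proof.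
move=> ms; rewrite /integral; congr (_ - _); congr (ereal_sup _); apply/seteqP;
  split => _ [h hf <-]; exists h => //; apply: eq_fsbigr => r _; rewrite ms//.
Qed.

Lemma integral_ge0_eq0 (m : {measure set TR -> \bar R}) (k : TR -> R) :
  measurable_fun setT k -> (forall x, (0 <= k x)%R) ->
  \int[m]_x (k x)%:E = 0 -> {ae m, forall x, k x = 0%R}.
Proof.
move=> mk k0.
rewrite (_ : \int[m]_x (k x)%:E = \int[m]_x `|(k x)%:E|); last first.
  by apply: eq_integral => x _; rewrite gee0_abs// lee_fin.
have mEk : measurable_fun setT (fun x => (k x)%:E) by exact/measurable_EFinP.
move/(ae_eq_integral_abs m measurableT mEk).1.
by apply: ae_mp => x /(_ I) [].
Qed.

(** [nu] is absolutely continuous, and [w] is almost everywhere its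
    Radon-Nikodym derivative since both have the same integrals over measurable
    sets. *)
Lemma ge0_integral_density (nu : {finite_measure set TR -> \bar R})
    (w : TR -> R) (f : TR -> \bar R) :
  measurable_fun setT w -> (forall x, (0 <= w x)%R) ->
  (forall B, measurable B -> nu B = \int[mu]_(x in B) (w x)%:E) ->
  measurable_fun setT f -> (forall x, 0 <= f x) ->
  \int[nu]_x f x = \int[mu]_x (f x * (w x)%:E).
Proof.
move=> mw w0 nuE mf f0.
have mEw : measurable_fun setT (fun x => (w x)%:E) by exact/measurable_EFinP.
have dom : nu `<< mu.
  apply/null_content_dominatesP => A mA muA; rewrite nuE//.
  by apply: null_set_integral => //; exact: measurable_funTS.
rewrite -(Radon_Nikodym_SigmaFinite.change_of_variables dom f0 measurableT mf).
have iRN := Radon_Nikodym_SigmaFinite.f_integrable dom.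
have h : ae_eq mu setT (Radon_Nikodym_SigmaFinite.f nu mu) (fun x => (w x)%:E).
  apply: integral_ae_eq => // E _ mE.
  by rewrite -nuE// -(Radon_Nikodym_SigmaFinite.f_integral dom).
apply: ge0_ae_eq_integral => //.
- by apply: emeasurable_funM => //; exact: measurable_int iRN.
- exact: emeasurable_funM.
- by move=> x _; rewrite mule_ge0// (Radon_Nikodym_SigmaFinite.f_ge0 dom).
- by move=> x _; rewrite mule_ge0// lee_fin.
- by apply: ae_mp h => x /= h _; rewrite h.
Qed.

(** This change of variables serves both for the spectral masses of
    multiplication operators and for the Gaussian law. For positive and
    negative parts it combines the image measure with the density formula. *)
Lemma integral_law (s : set TR -> \bar R) (w : TR -> R) (phi : TR -> TR)
    (f : TR -> R) :
  measurable_fun setT w -> (forall x, (0 <= w x)%R) ->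
  \int[mu]_x (w x)%:E < +oo -> measurable_fun setT phi ->
  (forall B, measurable B -> s B = \int[mu]_(x in phi @^-1` B) (w x)%:E) ->
  measurable_fun setT f ->
  \int[s]_x (f x)%:E = \int[mu]_x (f (phi x) * w x)%:E.
Proof.
move=> mw w0 iw mphi sE mf.
have mEw : measurable_fun setT (fun x => (w x)%:E) by exact/measurable_EFinP.
have [|||nu nuE] := @finite_measure_of (fun B => \int[mu]_(x in B) (w x)%:E) _ _ _ iw.
- exact: integral_set0.
- by move=> B _; apply: integral_ge0 => x _; rewrite lee_fin.
- by apply: semi_sigma_additive_nng_induced => // x; rewrite lee_fin.
rewrite (@eq_setfun_integral s (pushforward nu phi)); last first.
  by move=> B mB; rewrite sE// -nuE// -[X in measurable X]setTI; exact: mphi.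
have key (g : TR -> \bar R) : measurable_fun setT g -> (forall x, 0 <= g x) ->
    \int[pushforward nu phi]_x g x = \int[mu]_x (g (phi x) * (w x)%:E).
  move=> mg g0; rewrite (@ge0_integral_pushforward _ _ _ _ _ _ mphi)//.
  rewrite preimage_setT (@ge0_integral_density nu w)//; last first.
    by move=> x; exact: g0.
  exact: (measurableT_comp mg mphi).
have mEf : measurable_fun setT (fun x => (f x)%:E) by exact/measurable_EFinP.
have maxM (a b : R) : (0 <= b)%R ->
    maxe (a * b)%:E 0%:E = maxe a%:E 0%:E * b%:E.
  by move=> b0; rewrite -!EFin_max -EFinM maxr_pMl// mul0r.
rewrite integralE [RHS]integralE; congr (_ - _).
  rewrite key//; last exact: measurable_funepos.
  by apply: eq_integral => x _; rewrite !funeposE maxM.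
rewrite key//; last exact: measurable_funeneg.
by apply: eq_integral => x _; rewrite !funenegE -!EFinN -mulNr maxM.
Qed.

Lemma cintegral_law (s : set TR -> \bar R) (w : TR -> R) (phi : TR -> TR)
    (h : R -> C) :
  measurable_fun setT w -> (forall x, (0 <= w x)%R) ->
  \int[mu]_x (w x)%:E < +oo -> measurable_fun setT phi ->
  (forall B, measurable B -> s B = \int[mu]_(x in phi @^-1` B) (w x)%:E) ->
  cmeasurable h ->
  cintegral s h = cintegral mu (fun x => (h (phi x) * (w x)%:C)%R).
Proof.
move=> mw w0 iw mphi sE [mr mi]; rewrite /cintegral.
rewrite !(integral_law mw w0 iw mphi sE)//.
by congr (fine _ +i* fine _); apply: eq_integral => x _;
  rewrite ?cReM ?cImM /= ?mulr0 ?subr0 ?add0r.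
Qed.

End measures.

(** * Vectors of L^2 and multiplication operators *)

Section L2_theory.
Context {R : realType}.
Local Notation C := R[i].
Local Notation H := (L2 R).
Local Notation TR := (measurableTypeR R).
Local Notation mu := (@lebesgue_measure R).
Implicit Types (u v w : H) (f g : R -> C) (c : C).
Local Open Scope quotient_scope.

Lemma repr_sqint u : square_integrable (repr u).
Proof. by apply/asboolP; exact: (valP (repr u)). Qed.

Lemma repr_cmeasurable u : cmeasurable (repr u).
Proof. by have /sqintP[] := repr_sqint u. Qed.

Lemma L2_ext u v : {ae mu, forall x, repr u x = repr v x} -> u = v.
Proof.
move=> uv; rewrite -[u]reprK -[v]reprK; apply/L2_piP/asboolP.
by apply: ae_mp uv => x uvx; rewrite -[LHS]/(repr u x - repr v x) uvx subrr.
Qed.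

Lemma repr_pi (h : sqfun R) : {ae mu, forall x, repr (\pi_(L2 R) h) x = h x}.
Proof.
have /L2_piP/asboolP : \pi_(L2 R) (repr (\pi_(L2 R) h)) = \pi_(L2 R) h by rewrite reprK.
by apply: ae_mp => x /eqP; rewrite -[X in X == _]/(_ - _) subr_eq0 => /eqP.
Qed.

Lemma repr_L2_class f : square_integrable f ->
  {ae mu, forall x, repr (L2_class f) x = f x}.
Proof.
move=> hf; have := repr_pi (insubd (0 : sqfun R) f).
apply: ae_mp => x; rewrite /L2_class => ->.
by rewrite -[LHS]/(val (insubd (0 : sqfun R) f) x) val_insubd ifT//; exact/asboolP.
Qed.

Lemma reprD u v : {ae mu, forall x, repr (u + v) x = repr u x + repr v x}.
Proof.
have -> : u + v = \pi_(L2 R) (repr u + repr v) by rewrite L2_piD !reprK.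
exact: repr_pi.
Qed.

Lemma reprZ c u : {ae mu, forall x, repr (c *: u) x = c * repr u x}.
Proof. by exact: repr_pi. Qed.

Lemma repr_lin c u v :
  {ae mu, forall x, repr (c *: u + v) x = c * repr u x + repr v x}.
Proof.
apply: ae_mp2 (reprD (c *: u) v) (reprZ c u) => x -> ->; exact: erefl.
Qed.

Lemma inner_integrable u v :
  cintegrable mu (fun x => conjc (repr u x) * repr v x).
Proof. by apply: sqint_mul; [apply: sqintJ|]; exact: repr_sqint. Qed.

Lemma inner_cmeasurable f g : cmeasurable f -> cmeasurable g ->
  cmeasurable (fun x => conjc (f x) * g x).
Proof. by move=> mf mg; apply: cmeasurableM => //; exact: cmeasurableJ. Qed.

Lemma inner_ae u v f g : cmeasurable f -> cmeasurable g ->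
  {ae mu, forall x, repr u x = f x} -> {ae mu, forall x, repr v x = g x} ->
  inner u v = cintegral mu (fun x => conjc (f x) * g x).
Proof.
move=> mf mg uf vg; apply: ae_eq_cintegral.
- by apply: inner_cmeasurable; exact: repr_cmeasurable.
- exact: inner_cmeasurable.
- by apply: ae_mp2 uf vg => x -> ->.
Qed.

Lemma inner_linr c u v w : inner u (c *: v + w) = c * inner u v + inner u w.
Proof.
rewrite /inner -cintegralZ; last exact: inner_integrable.
rewrite -cintegralD; [|apply: cintegrableZ|]; try exact: inner_integrable.
apply: ae_eq_cintegral.
- by apply: inner_cmeasurable; exact: repr_cmeasurable.
- apply: cmeasurableD; [apply: cmeasurableM; [exact: cmeasurable_cst|]|];
  by apply: inner_cmeasurable; exact: repr_cmeasurable.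
- by apply: ae_mp (repr_lin c v w) => x ->; ring.
Qed.

Lemma innerJ u v : inner v u = conjc (inner u v).
Proof.
rewrite -cintegralJ; last exact: inner_integrable.
by apply: eq_cintegral => x; rewrite conjcM conjcK mulrC.
Qed.

Lemma inner_linl c u v w :
  inner (c *: u + v) w = conjc c * inner u w + inner v w.
Proof. by rewrite innerJ inner_linr conjcD conjcM -!innerJ. Qed.

Lemma innerDr u v w : inner u (v + w) = inner u v + inner u w.
Proof. by rewrite -[v]scale1r inner_linr mul1r scale1r. Qed.

Lemma inner0r u : inner u 0 = 0.
Proof. by apply: (addrI (inner u 0)); rewrite -innerDr !addr0. Qed.

Lemma innerZr c u v : inner u (c *: v) = c * inner u v.
Proof. by rewrite -[c *: v]addr0 inner_linr inner0r addr0. Qed.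

Lemma innerNr u v : inner u (- v) = - inner u v.
Proof. by rewrite -scaleN1r innerZr mulN1r. Qed.

Lemma innerBr u v w : inner u (v - w) = inner u v - inner u w.
Proof. by rewrite innerDr innerNr. Qed.

Lemma innerDl u v w : inner (u + v) w = inner u w + inner v w.
Proof. by rewrite innerJ innerDr conjcD -!innerJ. Qed.

Lemma innerZl c u v : inner (c *: u) v = conjc c * inner u v.
Proof. by rewrite innerJ innerZr conjcM -innerJ. Qed.

Lemma innerBl u v w : inner (u - v) w = inner u w - inner v w.
Proof. by rewrite innerJ innerBr conjcD conjcN -!innerJ. Qed.

Definition sqnorm u : R := complex.Re (inner u u).

Lemma sqnormE u : (sqnorm u)%:E = (\int[mu]_x (normc (repr u x) ^+ 2)%:E)%E.
Proof.
rewrite /sqnorm /inner /cintegral/= fineK; last first.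
  by apply: integrable_fin_num => //; exact: (inner_integrable u u).1.
by apply: eq_integral => x _; rewrite mulJc.
Qed.

Lemma inner_self u : inner u u = (sqnorm u)%:C.
Proof.
have h : complex.Im (inner u u) = - complex.Im (inner u u).
  by rewrite {1}innerJ cImJ.
by apply: complexP => //; rewrite [RHS]/=; lra.
Qed.

Lemma sqnorm_ge0 u : 0 <= sqnorm u.
Proof.
by rewrite -lee_fin sqnormE; apply: integral_ge0 => x _; rewrite lee_fin sqr_ge0.
Qed.

Lemma repr0 : {ae mu, forall x, repr (0 : H) x = 0}.
Proof. by apply: ae_mp (reprZ 0 0) => x; rewrite scale0r mul0r. Qed.

Lemma sqnorm_eq0 u : sqnorm u = 0 -> u = 0.
Proof.
move=> u0; apply: L2_ext.
have h : {ae mu, forall x, repr u x = 0}.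
  have mN := measurable_normc2 (repr_cmeasurable u).
  have := sqnormE u; rewrite u0 => /esym /(integral_ge0_eq0 mN (fun=> sqr_ge0 _)).
  by apply: ae_mp => x /eqP; rewrite sqrf_eq0 => /eqP; exact: eq0_normc.
by apply: ae_mp2 h repr0 => x -> ->.
Qed.

End L2_theory.

Section multiplication_operators.
Context {R : realType}.
Local Notation C := R[i].
Local Notation H := (L2 R).
Local Notation TR := (measurableTypeR R).
Local Notation mu := (@lebesgue_measure R).
Implicit Types (u v w : H) (f g : R -> C) (c : C).

Definition mult_dom f : set H :=
  [set u : H | square_integrable (fun x => f x * repr u x)].

(** Meaningful on [mult_dom f] only: elsewhere the value is 0. *)
Definition mult f u : H := L2_class (fun x => f x * repr u x).

Lemma mult_repr f u : mult_dom f u ->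
  {ae mu, forall x, repr (mult f u) x = f x * repr u x}.
Proof. exact: repr_L2_class. Qed.

(** Recognizes the image of [u] from its values; membership in the domain comes
    for free because [w] is square integrable. *)
Lemma multP f u w : cmeasurable f ->
  {ae mu, forall x, repr w x = f x * repr u x} ->
  mult_dom f u /\ mult f u = w.
Proof.
move=> mf wfu; have fu : mult_dom f u.
  apply: sqint_ae wfu (repr_sqint w).
  by apply: cmeasurableM => //; exact: repr_cmeasurable.
split => //; apply: L2_ext.
by apply: ae_mp2 (mult_repr fu) wfu => x -> ->.
Qed.

Lemma mult_dom_bounded f (M : R) u : cmeasurable f ->
  (forall x, normc (f x) ^+ 2 <= M ^+ 2) -> mult_dom f u.
Proof.
move=> mf fM; apply: (@sqint_le _ _ (fun x => M%:C * repr u x)).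
- by apply: cmeasurableM => //; exact: repr_cmeasurable.
- by apply: sqintZ; exact: repr_sqint.
- move=> x; rewrite !normcM !exprMn ler_wpM2r ?sqr_ge0//.
  by rewrite [leRHS]Defs.sqr_normc /= expr0n addr0.
Qed.

Lemma mult_dom_lin f c u v : cmeasurable f ->
  mult_dom f u -> mult_dom f v -> mult_dom f (c *: u + v).
Proof.
move=> mf fu fv.
apply: (@sqint_ae _ (fun x => c * (f x * repr u x) + f x * repr v x)).
- by apply: cmeasurableM => //; exact: repr_cmeasurable.
- by apply: ae_mp (repr_lin c u v) => x ->; ring.
- exact: sqint_lin.
Qed.

Lemma mult_lin f c u v : cmeasurable f ->
  mult_dom f u -> mult_dom f v ->
  mult f (c *: u + v) = c *: mult f u + mult f v.
Proof.
move=> mf fu fv; apply: (multP mf _).2.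
have h := ae_mp2 _ (repr_lin c u v) (repr_lin c (mult f u) (mult f v)).
have {}h := h _ (fun x p q => conj p q).
apply: ae_mp2 h _; last first.
  by apply: (ae_mp2 (fun x p q => conj p q)) (mult_repr fu) (mult_repr fv).
by move=> x [/= -> ->] [/= -> ->]; ring.
Qed.

Lemma inner_mult f u v : cmeasurable f -> mult_dom f v ->
  inner u (mult f v) =
  cintegral mu (fun x => conjc (repr u x) * (f x * repr v x)).
Proof.
move=> mf fv; apply: inner_ae; first exact: repr_cmeasurable.
- by apply: cmeasurableM => //; exact: repr_cmeasurable.
- exact: aeW.
- exact: mult_repr.
Qed.

Lemma inner_mult_self f u : cmeasurable f -> mult_dom f u ->
  inner u (mult f u) =
  cintegral mu (fun x => f x * (normc (repr u x) ^+ 2)%:C).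
Proof.
move=> mf fu; rewrite inner_mult//; apply: eq_cintegral => x.
by rewrite -mulJc; ring.
Qed.

Lemma mult_domJ f u : cmeasurable f -> mult_dom f u ->
  mult_dom (fun x => conjc (f x)) u.
Proof.
move=> mf fu; apply: sqint_le (fu) _.
  apply: cmeasurableM; [exact: cmeasurableJ|exact: repr_cmeasurable].
by move=> x; rewrite !normcM !exprMn normcJ_sq.
Qed.

Lemma mult_adj f u v : cmeasurable f -> mult_dom f u -> mult_dom f v ->
  inner u (mult f v) = inner (mult (fun x => conjc (f x)) u) v.
Proof.
move=> mf fu fv; have mJ := cmeasurableJ mf.
rewrite [RHS]innerJ !inner_mult//; last exact: mult_domJ.
rewrite -cintegralJ; last first.
  by apply: sqint_mul; [apply: sqintJ; exact: repr_sqint|exact: mult_domJ].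
by apply: eq_cintegral => x; rewrite !conjcM !conjcK; ring.
Qed.

(** The vector [w = d / (1 + |f|^2)] lies in the domain, and [inner w d] is the
    integral of [|d|^2] against a positive weight. *)
Lemma mult_dom_dense f d : cmeasurable f ->
  (forall w, mult_dom f w -> inner w d = 0) -> d = 0.
Proof.
move=> mf fd; pose g x : C := ((1 + normc (f x) ^+ 2)^-1)%:C.
have mg : cmeasurable g.
  apply: cmeasurable_real; apply: measurable_inv1D => [|x]; last exact: sqr_ge0.
  exact: measurable_normc2.
have g0 x : 0 < 1 + normc (f x) ^+ 2 by rewrite ltr_pwDl// sqr_ge0.
have gd : mult_dom g d.
  apply: (@mult_dom_bounded _ 1) => // x.
  rewrite Defs.sqr_normc/= expr0n addr0 ler_sqr ?nnegrE ?invr_ge0 ?(ltW (g0 x))//.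
  by rewrite invf_le1// lerDl sqr_ge0.
have fgd : mult_dom f (mult g d).
  apply: (@sqint_ae _ (fun x => f x * g x * repr d x)).
  - by apply: cmeasurableM => //; exact: repr_cmeasurable.
  - by apply: ae_mp (mult_repr gd) => x ->; rewrite mulrA.
  - apply: (@mult_dom_bounded _ 1); first exact: cmeasurableM.
    move=> x; rewrite normcM exprMn [normc (g x) ^+ 2]Defs.sqr_normc/=.
    rewrite expr0n addr0 expr1n -ler_pdivlMr ?exprn_gt0 ?invr_gt0//.
    rewrite mul1r -exprVn invrK; move: (g0 x) (sqr_ge0 (normc (f x))).
    by move: (normc (f x) ^+ 2) => n n0 n1; nra.
have := fd _ fgd; rewrite innerJ inner_mult_self// => h.
pose k x := (1 + normc (f x) ^+ 2)^-1 * normc (repr d x) ^+ 2.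
have k0 x : 0 <= k x by rewrite mulr_ge0 ?sqr_ge0// invr_ge0 ltW.
have [ir _] : cintegrable mu (fun x => conjc (repr d x) * (g x * repr d x)).
  by apply: sqint_mul => //; apply: sqintJ; exact: repr_sqint.
have {}ir : mu.-integrable setT (fun x => (k x)%:E).
  apply: eq_integrable ir => // x _; congr EFin.
  by rewrite mulrCA mulJc cReM /= mulr0 subr0.
have ik : (\int[mu]_x (k x)%:E = 0)%E.
  move/(congr1 (@complex.Re _)) : h; rewrite cReJ /cintegral /= => h.
  rewrite -[LHS]fineK; last exact: integrable_fin_num.
  congr EFin; rewrite -[RHS]h; congr fine; apply: eq_integral => x _.
  by congr EFin; rewrite /k /= mulr0 subr0.
have mk : measurable_fun [set: TR] k.
  by apply/measurable_EFinP; exact: (measurable_int mu ir).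
have d0 : {ae mu, forall x, repr d x = 0}.
  apply: ae_mp (integral_ge0_eq0 mk k0 ik) => x /eqP.
  rewrite mulf_eq0 invr_eq0 (gt_eqF (g0 x))/= sqrf_eq0 => /eqP; exact: eq0_normc.
by apply: L2_ext; apply: ae_mp2 d0 (repr0) => x -> ->.
Qed.

Lemma mult_affine (h : TR -> R) (a b : R) u : measurable_fun setT h ->
  mult_dom (fun x => (h x)%:C) u ->
  mult_dom (fun x => (a * h x + b)%:C) u /\
  mult (fun x => (a * h x + b)%:C) u =
    a%:C *: mult (fun x => (h x)%:C) u + b%:C *: u.
Proof.
move=> mh hu; apply: multP.
  by apply: cmeasurable_real; apply: measurable_funD => //; exact: measurable_funM.
have e := ae_mp2 (fun x p q => conj p q) (mult_repr hu) (reprZ b%:C u).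
apply: ae_mp2 (repr_lin a%:C (mult (fun x => (h x)%:C) u) (b%:C *: u)) e.
by move=> x -> [-> ->]; rewrite rmorphD rmorphM/=; ring.
Qed.

End multiplication_operators.

(** * Operators with a spectral measure *)

Section projection_valued_measures.
Context {R : realType}.
Local Notation C := R[i].
Local Notation H := (L2 R).
Local Notation TR := (measurableTypeR R).
Implicit Types (u v w : H) (B : set TR).
Variable E : set TR -> H -> H.
Hypothesis pvmE : projection_valued_measure E.

Lemma pvm_lin B (c : C) u v : measurable B ->
  E B (c *: u + v) = c *: E B u + E B v.
Proof. by move=> mB; case: pvmE => /(_ _ mB)[+ _ _] _ _ _ _; apply. Qed.

Lemma pvm0r B : measurable B -> E B 0 = 0.
Proof.
move=> mB; have := pvm_lin 1 0 0 mB; rewrite !scale1r addr0 => h.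
by apply: (addrI (E B 0)); rewrite -h addr0.
Qed.

Lemma pvmZ B (c : C) u : measurable B -> E B (c *: u) = c *: E B u.
Proof. by move=> mB; have := pvm_lin c u 0 mB; rewrite pvm0r// !addr0. Qed.

Lemma pvmD B u v : measurable B -> E B (u + v) = E B u + E B v.
Proof. by move=> mB; have := pvm_lin 1 u v mB; rewrite !scale1r. Qed.

Lemma pvmB B u v : measurable B -> E B (u - v) = E B u - E B v.
Proof.
by move=> mB; rewrite pvmD// -scaleN1r pvmZ// scaleN1r.
Qed.

Lemma pvm_idem B u : measurable B -> E B (E B u) = E B u.
Proof. by move=> mB; case: pvmE => /(_ _ mB)[_ + _] _ _ _ _; apply. Qed.

Lemma pvm_sym B u v : measurable B -> inner (E B u) v = inner u (E B v).
Proof. by move=> mB; case: pvmE => /(_ _ mB)[_ _ +] _ _ _ _; apply. Qed.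

Lemma pvmI A B u : measurable A -> measurable B -> E A (E B u) = E (A `&` B) u.
Proof. by move=> mA mB; case: pvmE => _ _ _ /(_ A B mA mB) -> _. Qed.

Lemma pvm0 u : E set0 u = 0.
Proof. by case: pvmE => _ -> _ _ _. Qed.

Lemma pvmT u : E setT u = u.
Proof. by case: pvmE => _ _ -> _ _. Qed.

Lemma pvmC A B u : measurable A -> measurable B -> E A (E B u) = E B (E A u).
Proof. by move=> mA mB; rewrite !pvmI// setIC. Qed.

Lemma spectral_massE B u : measurable B ->
  spectral_mass E u B = (sqnorm (E B u))%:E.
Proof. by move=> mB; rewrite /spectral_mass /sqnorm pvm_sym// pvm_idem. Qed.

Lemma exists_spectral_measure u : exists m : {finite_measure set TR -> \bar R},
  forall B, measurable B -> m B = spectral_mass E u B.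
Proof.
apply: finite_measure_of.
- by rewrite spectral_massE// pvm0 /sqnorm inner0r.
- by move=> B mB; rewrite spectral_massE// lee_fin sqnorm_ge0.
- by case: pvmE.
- by rewrite spectral_massE// ltry.
Qed.

Definition mass_measure u : {finite_measure set TR -> \bar R} :=
  sval (cid (exists_spectral_measure u)).

Lemma mass_measureE u B : measurable B ->
  (mass_measure u : {measure set TR -> \bar R}) B = (sqnorm (E B u))%:E.
Proof.
move=> mB; rewrite /mass_measure; case: cid => m mE; rewrite -spectral_massE//.
exact: mE.
Qed.

Lemma mass_null u B : measurable B -> E B u = 0 -> mass_measure u B = 0%E.
Proof.
by move=> mB Bu; have := mass_measureE u mB; rewrite Bu /sqnorm inner0r.
Qed.

Lemma integral_spectral_mass u (f : TR -> \bar R) :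
  (\int[spectral_mass E u]_x f x = \int[mass_measure u]_x f x)%E.
Proof.
apply: eq_setfun_integral => B mB.
by rewrite spectral_massE//; exact: mass_measureE.
Qed.

Lemma sqnorm_orth u v : inner u v = 0 -> sqnorm (u + v) = sqnorm u + sqnorm v.
Proof.
move=> uv; rewrite /sqnorm innerDl !innerDr uv (innerJ u v) uv conjc0.
by rewrite addr0 add0r cReD.
Qed.

(** [E A] commutes with [E B], so that [E A u] and [E A v] stay in the orthogonal
    ranges of [E B] and of its complement. *)
Lemma mass_orth B u v A : measurable B -> measurable A ->
  E B u = u -> E B v = 0 ->
  sqnorm (E A (u + v)) = sqnorm (E A u) + sqnorm (E A v).
Proof.
move=> mB mA Bu Bv; rewrite pvmD// sqnorm_orth//.
by rewrite -Bu pvmC// pvm_sym// pvmC// Bv pvm0r// inner0r.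
Qed.

Section operator.
Variable A : operator R.
Hypothesis intA : spectral_integral E (real_complex R) A.

Lemma dom_spectral u :
  dom A u <-> (\int[mass_measure u]_x (x ^+ 2)%:E < +oo)%E.
Proof.
case: intA => -> _ _ /=; rewrite integral_spectral_mass.
suff -> : (\int[mass_measure u]_x (normc (real_complex R x) ^+ 2)%:E =
           \int[mass_measure u]_x (x ^+ 2)%:E)%E by [].
by apply: eq_integral => x _; rewrite Defs.sqr_normc/= expr0n addr0.
Qed.

Lemma mass_integrable u : dom A u ->
  (mass_measure u).-integrable setT (fun x => x%:E).
Proof.
move=> /dom_spectral u2; apply: (@le_integrable _ TR R (mass_measure u) setT measurableT _
  (fun x : TR => ((cst 1 x)%:E + (x ^+ 2)%:E)%E)).
- by apply/measurable_EFinP.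
- move=> x _ /=; rewrite lee_fin [leRHS]ger0_norm ?addr_ge0 ?sqr_ge0//.
  by rewrite ler_norml; apply/andP; split; have := sqr_ge0 (x + 1);
    have := sqr_ge0 (x - 1); nra.
apply: integrableD => //; first exact: finite_measure_integrable_cst.
apply/integrableP; split; first by apply/measurable_EFinP; exact: measurable_funX.
by under eq_integral do rewrite gee0_abs ?lee_fin ?sqr_ge0//.
Qed.

Lemma spectral_expectation u : dom A u ->
  inner u (act A u) = (\int[mass_measure u]_x x)%:C.
Proof.
case: intA => _ _ + Au => -> //; rewrite /cintegral !integral_spectral_mass.
by apply: complexP => //=; rewrite integral0.
Qed.

(** [E B] is a contraction commuting with [E], so the mass of [E B u] is
    dominated by that of [u]. *)
Lemma spectral_dom_proj B u : measurable B -> dom A u -> dom A (E B u).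
Proof.
move=> mB /dom_spectral u2; apply/dom_spectral; apply: le_lt_trans u2.
apply: ge0_le_measure_integral => //.
- move=> S mS; rewrite !mass_measureE// lee_fin.
  rewrite -(subrK (E B (E S u)) (E S u)) sqnorm_orth; last first.
    by rewrite innerBl (pvm_sym (E S u) _ mB) pvm_idem// subrr.
  by rewrite pvmC// lerDr sqnorm_ge0.
- by move=> x; rewrite lee_fin sqr_ge0.
- by apply/measurable_EFinP; exact: measurable_funX.
Qed.

Lemma operator_lin (c : C) u v : dom A u -> dom A v ->
  dom A (c *: u + v) /\ act A (c *: u + v) = c *: act A u + act A v.
Proof. by case: intA => _ + _; apply. Qed.

Lemma dom0 : dom A 0.
Proof.
apply/dom_spectral; rewrite (eq_measure_integral mzero) ?integral_measure_zero//.
by move=> S mS _; rewrite mass_measureE// pvm0r// /sqnorm inner0r.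
Qed.

Lemma domD u v : dom A u -> dom A v -> dom A (u + v).
Proof. by move=> Au Av; have [+ _] := operator_lin 1 Au Av; rewrite scale1r. Qed.

Lemma act0 : act A 0 = 0.
Proof.
have := (operator_lin 1 dom0 dom0).2; rewrite !scale1r addr0 => h.
by apply: (addrI (act A 0)); rewrite -h addr0.
Qed.

Lemma domZ (c : C) u : dom A u -> dom A (c *: u).
Proof. by move=> Au; have [+ _] := operator_lin c Au dom0; rewrite addr0. Qed.

Lemma actZ (c : C) u : dom A u -> act A (c *: u) = c *: act A u.
Proof.
by move=> Au; have [_] := operator_lin c Au dom0; rewrite act0 !addr0.
Qed.

Lemma actD u v : dom A u -> dom A v -> act A (u + v) = act A u + act A v.
Proof.
by move=> Au Av; have [_] := operator_lin 1 Au Av; rewrite !scale1r.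
Qed.

(** The form at a vector is the mean of its mass, and masses add up by
    [mass_orth]. *)
Lemma spectral_expectationD B u v : measurable B -> dom A u -> dom A v ->
  E B u = u -> E B v = 0 ->
  inner (u + v) (act A (u + v)) = inner u (act A u) + inner v (act A v).
Proof.
move=> mB Au Av Bu Bv; rewrite !spectral_expectation//; last exact: domD.
rewrite -[RHS]rmorphD/=; congr (_%:C).
rewrite /Rintegral -fineD; try by apply: integrable_fin_num => //; exact: mass_integrable.
rewrite -integral_measure_add//; try exact: mass_integrable.
congr fine; apply: eq_measure_integral => S mS _.
rewrite [RHS](_ : _ = mass_measure u S + mass_measure v S)%E; last exact: measure_addE.
by rewrite !mass_measureE// (mass_orth mB mS Bu Bv).
Qed.

(** Polarization of the additivity of the quadratic form: [A] is diagonal with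
    respect to the decomposition of the space by [E B]. *)
Lemma spectral_offdiag B u v : measurable B -> dom A u -> dom A v ->
  E B u = u -> E B v = 0 -> inner v (act A u) = 0 /\ inner u (act A v) = 0.
Proof.
move=> mB Au Av Bu Bv.
have h (c : C) : c * inner u (act A v) + conjc c * inner v (act A u) = 0.
  have Acv := domZ c Av.
  have := spectral_expectationD mB Au Acv Bu.
  rewrite pvmZ// Bv scaler0 => /(_ erefl); rewrite actD// actZ//.
  rewrite innerDl !innerDr !innerZl !innerZr => h.
  apply: (addrI (inner u (act A u) + conjc c * (c * inner v (act A v)))).
  by rewrite addr0 -[RHS]h; ring.
by have [-> ->] := sesquilinear_eq0 h.
Qed.

Lemma integral_mass_null u B (f : TR -> R) : measurable B -> E B u = 0 ->
  (mass_measure u).-integrable setT (fun x => (f x)%:E) ->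
  \int[mass_measure u]_x f x = \int[mass_measure u]_(x in ~` B) f x.
Proof.
move=> mB Bu fi; rewrite /Rintegral -setTD; congr fine.
apply: negligible_integral => //.
exact: mass_null.
Qed.

Lemma integral_mass_cst u B (b : R) : measurable B -> E B u = u ->
  \int[mass_measure u]_(x in B) b = b * sqnorm u.
Proof.
move=> mB Bu; rewrite Rintegral_cst//; congr (_ * _).
by rewrite -[sqnorm u]/(fine (sqnorm u)%:E) -{2}Bu -mass_measureE.
Qed.

Lemma pvm_compl B u : measurable B -> E B u = 0 -> E (~` B) u = u.
Proof.
move=> mB Bu; have mC := measurableC mB.
apply/eqP; rewrite eq_sym -subr_eq0; apply/eqP/sqnorm_eq0.
have : sqnorm u = sqnorm (E (~` B) u).
  apply: EFin_inj; rewrite -{1}(pvmT u) -!mass_measureE// -(setvU B).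
  rewrite measureU ?setICl// -[RHS]adde0; congr (_ + _)%E.
  exact: mass_null.
rewrite -{1}(subrK (E (~` B) u) u) sqnorm_orth; last first.
  by rewrite innerBl (pvm_sym u _ mC) pvm_idem// subrr.
lra.
Qed.

(** The mass of [u] is carried by the half line, hence its mean is at most [b]
    times the total mass. *)
Lemma spectral_le (b : R) u : dom A u -> E `]-oo, b[ u = u ->
  complex.Re (inner u (act A u)) <= b * sqnorm u.
Proof.
move=> Au bu; rewrite spectral_expectation//=.
have bu' : E (~` `]-oo, b[) u = 0.
  by rewrite -bu pvmI//; [rewrite setICl pvm0|exact: measurableC].
have ix := mass_integrable Au.
rewrite (integral_mass_null _ bu') ?setCK//; last exact: measurableC.
rewrite -(integral_mass_cst b _ bu)//; apply: le_Rintegral => //.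
- by apply: integrableS ix.
- exact: finite_measure_integrable_cst.
- by move=> x /=; rewrite in_itv /= => /ltW.
Qed.

Lemma spectral_ge (b : R) u : dom A u -> E `]-oo, b[ u = 0 ->
  b * sqnorm u <= complex.Re (inner u (act A u)).
Proof.
move=> Au bu; rewrite spectral_expectation//=.
have ix := mass_integrable Au; have mC := measurableC (measurable_itv `]-oo, b[).
rewrite (integral_mass_null _ bu)//.
rewrite -(integral_mass_cst b mC (pvm_compl _ bu))//; apply: le_Rintegral => //.
- exact: finite_measure_integrable_cst.
- by apply: integrableS ix.
- by move=> x /=; rewrite in_itv /= => /negP; rewrite -leNgt.
Qed.

(** By [spectral_offdiag], both sides have the same inner product with every
    vector of the domain. *)
Lemma spectral_commute B u : measurable B ->
  (forall d, (forall w, dom A w -> inner w d = 0) -> d = 0) ->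
  dom A u -> act A (E B u) = E B (act A u).
Proof.
move=> mB dense Au; apply/eqP; rewrite -subr_eq0; apply/eqP/dense => w Aw.
have ABu := spectral_dom_proj mB Au; have ABw := spectral_dom_proj mB Aw.
have AwB : dom A (w - E B w) by rewrite addrC -scaleN1r; apply: (operator_lin _ _ _).1.
have AuB : dom A (u - E B u) by rewrite addrC -scaleN1r; apply: (operator_lin _ _ _).1.
rewrite innerBr -pvm_sym//.
have BB v : E B (E B v) = E B v by exact: pvm_idem.
have CB v : E B (v - E B v) = 0 by rewrite pvmB// pvm_idem// subrr.
have h1 : inner (w - E B w) (act A (E B u)) = 0.
  exact: (spectral_offdiag mB ABu AwB (BB u) (CB w)).1.
have h2 : inner (E B w) (act A (u - E B u)) = 0.
  exact: (spectral_offdiag mB ABw AuB (BB w) (CB u)).2.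
have e1 : inner w (act A (E B u)) = inner (E B w) (act A (E B u)).
  by apply/eqP; rewrite -subr_eq0 -innerBl h1.
have e2 : inner (E B w) (act A u) = inner (E B w) (act A (E B u)).
  rewrite -{1}(subrK (E B u) u) actD// innerDr h2 add0r //.
by rewrite e1 e2 subrr.
Qed.
End operator.

End projection_valued_measures.

(** * Commuting projections with a nonpositive form *)

Section vanishing.
Context {R : realType}.
Local Notation C := R[i].
Local Notation H := (L2 R).
Local Notation TR := (measurableTypeR R).
Local Notation mu := (@lebesgue_measure R).
Implicit Types (u v w : H).

Lemma bernoulli_ge (k : R) n : 0 <= k -> 1 + n%:R * k <= (1 + k) ^+ n.
Proof.
move=> k0; elim: n => [|n ih]; first by rewrite mul0r addr0 expr0.
rewrite exprS; apply: (@le_trans _ _ ((1 + k) * (1 + n%:R * k))).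
  rewrite -natr1; have : 0 <= n%:R * (k * k) by rewrite !mulr_ge0.
  by nra.
by rewrite ler_wpM2l// addr_ge0.
Qed.

Variables (P : H -> H) (y : TR -> R).
Hypothesis my : measurable_fun setT y.
Local Notation Y := (fun x => (y x)%:C).
Hypothesis P_lin : forall (c : C) u v, P (c *: u + v) = c *: P u + P v.
Hypothesis P_comm : forall v, mult_dom Y v ->
  mult_dom Y (P v) /\ mult Y (P v) = P (mult Y v).

(* r = 1 / (y - i) is the resolvent, and |f|^2 = 1 + 2 y / (1 + y^2) exceeds 1
   exactly where y > 0. *)
Let r x : C := (1 + y x ^+ 2)^-1%:C * (y x +i* 1).
Let f x : C := (y x + 1)%:C * r x.

Let y2_gt0 x : 0 < 1 + y x ^+ 2. Proof. by rewrite ltr_pwDl// sqr_ge0. Qed.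

Let mr : cmeasurable r.
Proof.
apply: cmeasurableM.
  apply: cmeasurable_real; apply: measurable_inv1D; first exact: measurable_funX.
  by move=> x; exact: sqr_ge0.
by split => //=; exact: measurable_cst.
Qed.

Let mf : cmeasurable f.
Proof.
by apply: cmeasurableM => //; apply: cmeasurable_real; exact: measurable_funD.
Qed.

Let normr2 x : normc (r x) ^+ 2 = (1 + y x ^+ 2)^-1.
Proof.
rewrite normcM exprMn !Defs.sqr_normc/= expr0n expr1n addr0 [_ + 1]addrC.
by rewrite expr2 -mulrA mulVf ?mulr1// gt_eqF.
Qed.

Let normf2 x : normc (f x) ^+ 2 = (y x + 1) ^+ 2 / (1 + y x ^+ 2).
Proof. by rewrite normcM exprMn normr2 Defs.sqr_normc/= expr0n addr0. Qed.

Let f_bound x : normc (f x) ^+ 2 <= 2 ^+ 2.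
Proof.
rewrite normf2 ler_pdivrMr//; have := sqr_ge0 (y x - 1).
by move: (y x) => z; nra.
Qed.

Let resolventE x : (y x)%:C * r x = 1 + 'i * r x.
Proof.
rewrite /r; move: (y2_gt0 x); move: (y x) => z z0.
have z1 : z * ((1 + z ^+ 2)^-1 * z) = 1 - (1 + z ^+ 2)^-1.
  by apply: (mulIf (lt0r_neq0 z0)); field; exact: lt0r_neq0.
by apply: complexP; rewrite !(cReM, cImM, cReD, cImD) /=; lra.
Qed.

(** Every [u] is [(y - i) v] with [v = r u] in the domain of [y], and [P] commutes
    with [y - i]; hence [P] commutes with [r], and with [f = 1 + (1 + i) r]. *)
Lemma commute_resolvent u : P (mult f u) = mult f (P u).
Proof.
have ru : mult_dom r u.
  apply: (@mult_dom_bounded _ _ 1) => // x.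
  by rewrite normr2 expr1n invf_le1// lerDl sqr_ge0.
pose v := mult r u; have rv := mult_repr ru : {ae mu, forall x, repr v x = _}.
have Yr x : (y x)%:C * (r x * repr u x) = repr u x + 'i * (r x * repr u x).
  by rewrite [LHS]mulrA resolventE; ring.
have Yv : mult_dom Y v.
  apply: (@sqint_ae _ (fun x => 'i * repr v x + repr u x)).
  - by apply: cmeasurableM => //; exact: repr_cmeasurable.
  - by apply: ae_mp rv => x ->; rewrite Yr addrC.
  - by apply: sqint_lin; exact: repr_sqint.
have uv : u = (- 'i) *: v + mult Y v.
  apply: L2_ext; have h := ae_mp2 (fun x p q => conj p q) (mult_repr Yv) rv.
  apply: ae_mp2 (repr_lin (- 'i) v (mult Y v)) h.
  by move=> x -> [-> ->]; rewrite Yr; ring.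
have fu : mult f u = 1 *: mult Y v + v.
  apply: (multP mf _).2; have h := ae_mp2 (fun x p q => conj p q) (mult_repr Yv) rv.
  apply: ae_mp2 (repr_lin 1 (mult Y v) v) h.
  by move=> x -> [-> ->]; rewrite /f rmorphD/=; ring.
have [YPv PYv] := P_comm Yv.
have Pu : P u = (- 'i) *: P v + mult Y (P v) by rewrite {1}uv P_lin PYv.
rewrite fu P_lin -PYv; apply/esym; apply: (multP mf _).2.
have h := ae_mp2 (fun x p q => conj p q) (mult_repr YPv)
  (repr_lin (- 'i) (P v) (mult Y (P v))).
rewrite -Pu in h.
apply: ae_mp2 (repr_lin 1 (mult Y (P v)) (P v)) h.
move=> x -> [-> ->].
have rY (p : C) : r x * (- 'i * p + (y x)%:C * p) = p.
  transitivity (((y x)%:C * r x - 'i * r x) * p); first by ring.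
  by rewrite resolventE; ring.
by rewrite /f -mulrA rY rmorphD/=; ring.
Qed.

Let fn n x : C := f x ^+ n.

Let mfn n : cmeasurable (fn n).
Proof.
elim: n => [|n ih]; first exact: cmeasurable_cst.
by rewrite /fn; under eq_fun do rewrite exprS; exact: cmeasurableM.
Qed.

Let fn_dom n u : mult_dom (fn n) u.
Proof.
apply: (@mult_dom_bounded _ _ (2 ^+ n)) => // x.
rewrite /fn -exprM mulnC exprM; elim: n => [|n ih].
  by rewrite !expr0 normc1 expr1n.
rewrite !(exprS _ n) normcM exprMn ler_pM ?sqr_ge0//; exact: f_bound.
Qed.

Lemma commute_resolvent_pow n u : P (mult (fn n) u) = mult (fn n) (P u).
Proof.
elim: n u => [|n ih] u.
  have h w : mult (fn 0) w = w.
    by apply: (multP (mfn 0) _).2; apply: aeW => x; rewrite /fn expr0 mul1r.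
  by rewrite !h.
have h w : mult (fn n.+1) w = mult f (mult (fn n) w).
  apply: (multP (mfn n.+1) _).2.
  have fw : mult_dom f (mult (fn n) w) by exact: mult_dom_bounded f_bound.
  apply: ae_mp2 (mult_repr fw) (mult_repr (fn_dom n w)) => x -> ->.
  by rewrite /fn exprS mulrA.
by rewrite !h commute_resolvent ih.
Qed.

(** The vectors [f^n u] stay in the range of [P], so the integral of
    [y |f|^2n |u|^2] is nonpositive for all [n]. The weight [|f|^2n] is at most
    1 where [y <= 0] and grows at least linearly in [n] where [y > 0], by
    Bernoulli's inequality: the integral can stay bounded above only if [u]
    vanishes where [y > 0]. *)
Lemma negative_part_vanish :
  (forall u, P u = u -> mult_dom Y u -> complex.Re (inner u (mult Y u)) <= 0) ->
  forall u, P u = u -> mult_dom Y u ->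
  {ae mu, forall x, 0 < y x -> repr u x = 0}.
Proof.
move=> neg u Pu Yu.
pose N x : R := normc (repr u x) ^+ 2.
have N0 x : 0 <= N x by exact: sqr_ge0.
pose rho x : R := normc (f x) ^+ 2.
(* Where y > 0, Bernoulli's inequality reads y |f|^2n >= y + 2 n q. *)
pose q x : R := Order.max (y x) 0 ^+ 2 * (1 + y x ^+ 2)^-1.
have q0 x : 0 <= q x by rewrite mulr_ge0 ?sqr_ge0// invr_ge0 ltW.
have q1 x : q x <= 1.
  rewrite ler_pdivrMr// mul1r; have := sqr_ge0 (y x); case: (leP (y x) 0).
    by rewrite expr0n/=; lra.
  by move: (y x) => z; nra.
have mN : measurable_fun [set: TR] N by apply: measurable_normc2; exact: repr_cmeasurable.
have mq : measurable_fun [set: TR] q.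
  apply: measurable_funM.
    by apply: measurable_funX; apply: measurable_maxr.
  apply: measurable_inv1D; first exact: measurable_funX.
  by move=> x; exact: sqr_ge0.
have iN : mu.-integrable setT (fun x => (N x)%:E).
  have [+ _] := inner_integrable u u.
  by apply: eq_integrable => // x _; rewrite mulJc.
have iqN : mu.-integrable setT (fun x => (q x * N x)%:E).
  apply: le_integrable iN => //.
    by apply/measurable_EFinP; exact: measurable_funM.
  move=> x _ /=; rewrite lee_fin (ger0_norm (mulr_ge0 (q0 x) (N0 x))) (ger0_norm (N0 x)).
  by rewrite -[leRHS]mul1r ler_wpM2r.
have iyN n : mu.-integrable setT (fun x => (y x * rho x ^+ n * N x)%:E) /\
    (\int[mu]_x (y x * rho x ^+ n * N x)%:E <= 0)%E.
  have normfn x : normc (fn n x * repr u x) ^+ 2 = rho x ^+ n * N x.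
    rewrite normcM exprMn; congr (_ * _); rewrite /fn /rho; elim: n => [|k ih].
      by rewrite !expr0 normc1 expr1n.
    by rewrite !(exprS _ k) normcM exprMn ih.
  have sY : square_integrable (fun x => (y x)%:C * (fn n x * repr u x)).
    apply: sqint_ae (fn_dom n (mult Y u)).
    - by do 2![apply: cmeasurableM => //]; exact: repr_cmeasurable.
    - by apply: ae_mp (mult_repr Yu) => x ->; ring.
  have YF : mult_dom Y (mult (fn n) u).
    apply: sqint_ae sY; first by apply: cmeasurableM => //; exact: repr_cmeasurable.
    by apply: ae_mp (mult_repr (fn_dom n u)) => x ->.
  have ReE x : complex.Re (conjc (fn n x * repr u x) *
      ((y x)%:C * (fn n x * repr u x))) = y x * rho x ^+ n * N x.
    by rewrite mulrCA mulJc normfn -rmorphM/= mulrA.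
  have [ir _] := sqint_mul (sqintJ (fn_dom n u)) sY.
  have := neg (mult (fn n) u); rewrite commute_resolvent_pow Pu => /(_ erefl YF).
  rewrite (@inner_ae _ _ _ (fun x => fn n x * repr u x)
    (fun x => (y x)%:C * (fn n x * repr u x))); last 4 first.
  - by apply: cmeasurableM => //; exact: repr_cmeasurable.
  - by do 2![apply: cmeasurableM => //]; exact: repr_cmeasurable.
  - exact: mult_repr.
  - by apply: ae_mp2 (mult_repr YF) (mult_repr (fn_dom n u)) => x -> ->.
  rewrite /cintegral [complex.Re (_ +i* _)]/=.
  under eq_integral do rewrite ReE.
  have iyN : mu.-integrable setT (fun x => (y x * rho x ^+ n * N x)%:E).
    by apply: eq_integrable ir => // x _; rewrite ReE.
  by move=> le0; split => //; rewrite -[leLHS]fineK ?lee_fin// integrable_fin_num.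
have key n : (\int[mu]_x (y x * rho x ^+ 0 * N x)%:E +
   (2 * n%:R)%:E * \int[mu]_x (q x * N x)%:E <= 0)%E.
  have [iN0 _] := iyN 0%N; have [iNn le0] := iyN n.
  rewrite -integralZl// -integralD//; last exact: integrableZl.
  apply: le_trans le0; apply: le_integral => //.
    by apply: integrableD => //; exact: integrableZl.
  move=> x _; rewrite -EFinM -EFinD lee_fin expr0 mulr1.
  rewrite [leLHS](_ : _ = (y x + 2 * n%:R * q x) * N x); last by ring.
  rewrite ler_wpM2r//.
  have rhoE : rho x = 1 + 2 * y x / (1 + y x ^+ 2).
    by rewrite /rho normf2; field; exact: lt0r_neq0.
  rewrite /q; case: (leP (y x) 0) => y0.
    rewrite expr0n mul0r mulr0 addr0 -[leLHS]mulr1 ler_wnM2l// exprn_ile1//.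
      exact: sqr_ge0.
    by rewrite rhoE gerDl mulr_le0_ge0 ?invr_ge0 ?(ltW (y2_gt0 x))//; lra.
  have k0 : 0 <= 2 * y x / (1 + y x ^+ 2).
    by rewrite mulr_ge0 ?invr_ge0 ?(ltW (y2_gt0 x))//; lra.
  have := bernoulli_ge n k0; rewrite -rhoE => /(ler_wpM2l (ltW y0)).
  by apply: le_trans; rewrite le_eqVlt; apply/orP; left; apply/eqP; ring.
have qN0 : (\int[mu]_x (q x * N x)%:E = 0)%E.
  have [iN0 _] := iyN 0%N.
  move: key; rewrite -(fineK (integrable_fin_num measurableT iqN)).
  rewrite -(fineK (integrable_fin_num measurableT iN0)) => key.
  have Q0 : 0 <= fine (\int[mu]_x (q x * N x)%:E).
    by rewrite fine_ge0// integral_ge0// => x _; rewrite lee_fin mulr_ge0.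
  move: key Q0; set a := fine _; set b := fine _ => key b0.
  congr EFin; apply/eqP; rewrite eq_le b0 andbT leNgt; apply/negP => {b0} b0.
  have /= := key (Num.truncn (`|a| / b)).+1; rewrite -EFinM -EFinD lee_fin.
  have : `|a| / b < (Num.truncn (`|a| / b)).+1%:R by rewrite truncnS_gt.
  rewrite ltr_pdivrMr//; have := ler_norm (- a); rewrite normrN.
  have := normr_ge0 a; move: (_.+1%:R) => c; nra.
have := integral_ge0_eq0 (measurable_funM mq mN) _ qN0.
have qN_ge0 x : 0 <= (q \* N) x by rewrite mulr_ge0.
move/(_ qN_ge0); apply: ae_mp => x /eqP; rewrite mulf_eq0 => + y0.
rewrite mulf_eq0 invr_eq0 (gt_eqF (y2_gt0 x)) orbF !sqrf_eq0.
by rewrite max_l ?(ltW y0)// (gt_eqF y0)/= => /eqP; exact: eq0_normc.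
Qed.

End vanishing.

(** * The spectral measure of a multiplication operator *)

Section multiplication_spectral_measure.
Context {R : realType}.
Local Notation C := R[i].
Local Notation H := (L2 R).
Local Notation TR := (measurableTypeR R).
Local Notation mu := (@lebesgue_measure R).
Implicit Types (u v w : H) (B : set TR).

(** Equality of operators would be too strong, as it constrains [act] outside of
    the domain. *)
Definition acts_as_mult (A : operator R) (f : R -> C) : Prop :=
  dom A = mult_dom f /\ forall u, dom A u -> act A u = mult f u.

(** Comparing forms only tells [phi < b] from [phi > b]; this condition makes the
    boundary [phi = b] negligible. *)
Definition has_null_levels (phi : R -> R) :=
  forall b, {ae mu, forall x, phi x != b}.

Lemma injective_null_levels (phi : R -> R) :
  injective phi -> has_null_levels phi.
Proof.
move=> inj b; case: (pselect (exists x, phi x = b)) => [[x0 <-]|nb]; last first.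
  by apply: aeW => x; apply/eqP => xb; apply: nb; exists x.
exists [set x0]; split => //; first exact: lebesgue_measure_set1.
by move=> x /= /negP; rewrite negbK => /eqP /inj.
Qed.

Variable phi : TR -> TR.
Hypothesis mphi : measurable_fun setT phi.

Definition mult_pvm B u : H := mult (fun x => (\1_B (phi x))%:C) u.

Let mind B : measurable B -> cmeasurable (fun x => (\1_B (phi x))%:C : C).
Proof.
move=> mB; apply: cmeasurable_real.
by apply: (measurableT_comp _ mphi); exact: measurable_indic.
Qed.

Let ind_dom B u : measurable B -> mult_dom (fun x => (\1_B (phi x))%:C) u.
Proof.
move=> mB; apply: (@mult_dom_bounded _ _ 1) => [|x]; first exact: mind.
by rewrite Defs.sqr_normc/= expr0n addr0 indicE; case: (_ \in _);
  rewrite ?expr1n ?expr0n.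
Qed.

Lemma mult_pvmE B u : measurable B ->
  {ae mu, forall x, repr (mult_pvm B u) x = (\1_B (phi x))%:C * repr u x}.
Proof. by move=> mB; apply: mult_repr; exact: ind_dom. Qed.

Lemma mult_pvm_eq B u w : measurable B ->
  {ae mu, forall x, repr w x = (\1_B (phi x))%:C * repr u x} -> mult_pvm B u = w.
Proof. by move=> mB h; exact: (multP (mind mB) h).2. Qed.

Lemma mult_pvmI A B u : measurable A -> measurable B ->
  mult_pvm (A `&` B) u = mult_pvm A (mult_pvm B u).
Proof.
move=> mA mB; apply: mult_pvm_eq; first exact: measurableI.
apply: ae_mp2 (mult_pvmE (mult_pvm B u) mA) (mult_pvmE u mB) => x -> ->.
by rewrite mulrA -rmorphM/= indicI.
Qed.

Lemma mult_pvm_sym B u v : measurable B ->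
  inner (mult_pvm B u) v = inner u (mult_pvm B v).
Proof.
move=> mB; rewrite /mult_pvm (mult_adj (mind mB) (ind_dom _ mB) (ind_dom _ mB)).
suff -> : (fun x => conjc (\1_B (phi x))%:C) = (fun x => (\1_B (phi x))%:C : C) by [].
by apply/funext => x; rewrite conjc_real.
Qed.

Lemma sqnorm_mult_pvm B u : measurable B ->
  (sqnorm (mult_pvm B u))%:E =
  (\int[mu]_(x in phi @^-1` B) (normc (repr u x) ^+ 2)%:E)%E.
Proof.
move=> mB; rewrite sqnormE [RHS]integral_mkcond.
have mpB : measurable (phi @^-1` B).
  by rewrite -[X in measurable X]setTI; exact: mphi.
apply: ge0_ae_eq_integral => //.
- exact: measurable_Enormc2 (repr_cmeasurable _).
- apply/(measurable_restrictT _ _).1 => //; apply: measurable_funTS.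
  exact: measurable_Enormc2 (repr_cmeasurable _).
- by move=> x _; rewrite lee_fin sqr_ge0.
- by move=> x _; rewrite erestrict_ge0// => ? _; rewrite lee_fin sqr_ge0.
- apply: ae_mp (mult_pvmE u mB) => x -> _.
  rewrite patchE -[x \in _]/(phi x \in B) indicE; case: (_ \in _).
    by rewrite mul1r.
  by rewrite mul0r normc0 expr0n.
Qed.

Lemma mult_pvm_projection_valued : projection_valued_measure mult_pvm.
Proof.
have idem B u : measurable B -> mult_pvm B (mult_pvm B u) = mult_pvm B u.
  by move=> mB; rewrite -mult_pvmI// setIid.
have massE B u : measurable B -> spectral_mass mult_pvm u B =
    (\int[mu]_(x in phi @^-1` B) (normc (repr u x) ^+ 2)%:E)%E.
  move=> mB; rewrite /spectral_mass -sqnorm_mult_pvm// /sqnorm.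
  by rewrite (mult_pvm_sym _ _ mB) (idem _ _ mB).
split.
- move=> B mB; split.
  + move=> c u v; apply: mult_lin; [exact: mind|exact: ind_dom|exact: ind_dom].
  + by move=> u; exact: idem.
  + by move=> u v; exact: mult_pvm_sym.
- apply/funext => u; apply: mult_pvm_eq => //; apply: ae_mp repr0 => x ->.
  by rewrite indic0 mul0r.
- apply/funext => u; apply: mult_pvm_eq => //; apply: aeW => x.
  by rewrite indicT mul1r.
- by move=> A B mA mB; apply/funext => u; exact: mult_pvmI.
- move=> u F mF tF mUF; rewrite massE//.
  under eq_fun do under eq_bigr do rewrite massE//.
  rewrite preimage_bigcup.
  apply: semi_sigma_additive_nng_induced.
  + exact: measurable_Enormc2 (repr_cmeasurable _).
  + by move=> x; rewrite lee_fin sqr_ge0.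
  + by move=> n; rewrite -[X in measurable X]setTI; exact: mphi.
  + apply/trivIsetP => i j _ _ ij; rewrite -preimage_setI.
    by move/trivIsetP : tF => /(_ _ _ _ _ ij) ->//; rewrite preimage_set0.
  + by rewrite -preimage_bigcup -[X in measurable X]setTI; exact: mphi.
Qed.

End multiplication_spectral_measure.

(** * Uniqueness of the spectral measure and functional calculus *)

Opaque inner.

Section functional_calculus_of_multiplication.
Context {R : realType}.
Local Notation C := R[i].
Local Notation H := (L2 R).
Local Notation TR := (measurableTypeR R).
Local Notation mu := (@lebesgue_measure R).
Implicit Types (u v w : H) (B : set TR) (E : set TR -> H -> H).

Variable phi : TR -> TR.
Hypothesis mphi : measurable_fun setT phi.
Local Notation phiC := (fun x => (phi x)%:C).

(** All that the functional calculus sees of a spectral measure: [<u, E(.) u>] is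
    the law of [phi] under [|u|^2 dx]. *)
Definition mult_masses E := forall u B, measurable B ->
  spectral_mass E u B =
  (\int[mu]_(x in phi @^-1` B) (normc (repr u x) ^+ 2)%:E)%E.

Lemma mult_pvm_masses : mult_masses (mult_pvm phi).
Proof.
move=> u B mB; rewrite -sqnorm_mult_pvm//; apply: spectral_massE => //.
exact: mult_pvm_projection_valued.
Qed.

Section integrals.
Variable E : set TR -> H -> H.
Hypothesis massE : mult_masses E.

Lemma integral_mult_mass u (f : TR -> R) : measurable_fun setT f ->
  (\int[spectral_mass E u]_x (f x)%:E =
   \int[mu]_x (f (phi x) * normc (repr u x) ^+ 2)%:E)%E.
Proof.
move=> mf; apply: integral_law => //.
- by apply: measurable_normc2; exact: repr_cmeasurable.
- by move=> x; exact: sqr_ge0.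
- by rewrite -sqnormE ltry.
- by move=> B mB; exact: massE.
Qed.

Lemma cintegral_mult_mass u (psi : R -> C) : cmeasurable psi ->
  cintegral (spectral_mass E u) psi =
  cintegral mu (fun x => psi (phi x) * (normc (repr u x) ^+ 2)%:C).
Proof.
move=> mpsi; apply: cintegral_law => //.
- by apply: measurable_normc2; exact: repr_cmeasurable.
- by move=> x; exact: sqr_ge0.
- by rewrite -sqnormE ltry.
- by move=> B mB; exact: massE.
Qed.

Lemma mult_mass_dom u (psi : R -> C) : cmeasurable psi ->
  (\int[spectral_mass E u]_x (normc (psi x) ^+ 2)%:E < +oo)%E <->
  mult_dom (fun x => psi (phi x)) u.
Proof.
move=> mpsi; rewrite integral_mult_mass; last exact: measurable_normc2.
have mpp : cmeasurable (fun x => psi (phi x)) by exact: cmeasurable_comp.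
have -> : (\int[mu]_x (normc (psi (phi x)) ^+ 2 * normc (repr u x) ^+ 2)%:E =
    \int[mu]_x (normc (psi (phi x) * repr u x) ^+ 2)%:E)%E.
  by apply: eq_integral => x _; rewrite normcM exprMn.
rewrite /mult_dom /= sqintP; split=> [h|[]//]; split => //.
by apply: cmeasurableM => //; exact: repr_cmeasurable.
Qed.

Lemma mult_spectral_integral A (psi : R -> C) : cmeasurable psi ->
  acts_as_mult A (fun x => psi (phi x)) -> spectral_integral E psi A.
Proof.
move=> mpsi [domA actA].
have mpp : cmeasurable (fun x => psi (phi x)) by exact: cmeasurable_comp.
split.
- by rewrite domA; apply/seteqP; split=> u /=; rewrite mult_mass_dom.
- move=> c u v Au Av; have Acuv : dom A (c *: u + v).
    by move: Au Av; rewrite domA; exact: mult_dom_lin.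
  split => //; rewrite !actA//; apply: mult_lin => //; by rewrite -domA.
- move=> u Au; rewrite actA// inner_mult_self -?domA// cintegral_mult_mass//.
Qed.

(** The difference [T] of the two operators has a vanishing quadratic form, so
    [<w, T u>] vanishes by polarization for all [w] in the domain, which is
    dense. *)
Lemma spectral_integral_acts A (psi : R -> C) : cmeasurable psi ->
  spectral_integral E psi A -> acts_as_mult A (fun x => psi (phi x)).
Proof.
move=> mpsi [domA linA quadA].
have mpp : cmeasurable (fun x => psi (phi x)) by exact: cmeasurable_comp.
have domE : dom A = mult_dom (fun x => psi (phi x)).
  by rewrite domA; apply/seteqP; split=> u /=; rewrite mult_mass_dom.
split => // u Au; apply/eqP; rewrite -subr_eq0; apply/eqP.
apply: (mult_dom_dense mpp) => w; rewrite -domE => Aw.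
pose T v := act A v - mult (fun x => psi (phi x)) v.
have T0 v : dom A v -> inner v (T v) = 0.
  move=> Av; rewrite /T innerBr quadA// inner_mult_self -?domE//.
  by rewrite cintegral_mult_mass// subrr.
have Tlin c v z : dom A v -> dom A z -> T (c *: v + z) = c *: T v + T z.
  move=> Av Az; rewrite /T (linA c v z Av Az).2 mult_lin -?domE//.
  by rewrite scalerBr opprD addrACA.
apply: (sesquilinear_eq0 (z := inner u (T w)) _).2 => c.
have := T0 (c *: w + u) (linA c w u Aw Au).1.
rewrite (Tlin _ _ _ Aw Au) inner_linl !inner_linr (T0 w Aw) (T0 u Au).
move: (inner u (T w)) (inner w (T u)) => X Y.
by rewrite mulr0 add0r addr0 => <-; exact: addrC.
Qed.

End integrals.

Section uniqueness.
Hypothesis phi_levels : has_null_levels phi.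
Variables (A : operator R) (E : set TR -> H -> H).
Hypothesis phiA : acts_as_mult A phiC.
Hypothesis specE : spectral_measure A E.

Let pvmE : projection_valued_measure E. Proof. by case: specE. Qed.
Let intE : spectral_integral E (real_complex R) A. Proof. by case: specE. Qed.
Let domE : dom A = mult_dom phiC. Proof. by case: phiA. Qed.
Let actE u : dom A u -> act A u = mult phiC u. Proof. by case: phiA => _; apply. Qed.

(** [negative_part_vanish] for the multiplier [a phi + b], whose domain is that
    of [A] because [a] is nonzero. *)
Lemma affine_vanish (P : H -> H) (a b : R) u : a != 0 ->
  (forall (c : C) v w, P (c *: v + w) = c *: P v + P w) ->
  (forall v, dom A v -> dom A (P v) /\ act A (P v) = P (act A v)) ->
  (forall v, P v = v -> dom A v ->
     a * complex.Re (inner v (act A v)) + b * sqnorm v <= 0) ->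
  P u = u -> dom A u -> {ae mu, forall x, 0 < a * phi x + b -> repr u x = 0}.
Proof.
move=> a0 Plin Pcomm Pneg Pu Au.
have my : measurable_fun [set: TR] (fun x => a * phi x + b).
  by apply: measurable_funD => //; exact: measurable_funM.
have domy v : mult_dom (fun x => (a * phi x + b)%:C) v -> dom A v.
  move=> /(mult_affine a^-1 (- (b / a)) my)[+ _]; rewrite domE.
  by under eq_fun do rewrite mulrDr mulKf// mulrC addrK.
have P0 : P 0 = 0.
  have := Plin 1 0 0; rewrite !scale1r addr0 => h.
  by apply: (addrI (P 0)); rewrite -h addr0.
apply: (@negative_part_vanish _ P _ my) => //.
- move=> v /domy Av; have [APv APvE] := Pcomm v Av.
  have [d1 e1] := mult_affine a b mphi (eq_ind _ (fun D : set H => D v) Av _ domE).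
  have [d2 e2] := mult_affine a b mphi (eq_ind _ (fun D : set H => D (P v)) APv _ domE).
  split => //; rewrite e1 e2 Plin -!actE// APvE.
  by rewrite -[P (b%:C *: v)]/(P _) -[b%:C *: v in RHS]addr0 Plin P0 addr0.
- move=> v Pv /domy Av.
  have [d1 e1] := mult_affine a b mphi (eq_ind _ (fun D : set H => D v) Av _ domE).
  rewrite e1 inner_linr innerZr -actE// inner_self -rmorphM/=.
  by rewrite cReD cReM/= mul0r subr0; exact: Pneg.
- by have [] := mult_affine a b mphi (eq_ind _ (fun D : set H => D u) Au _ domE).
Qed.

Let below (b : R) : set TR := `]-oo, b[%classic.
Let mbelow b : measurable (below b). Proof. exact: measurable_itv. Qed.

Let dense d : (forall w, dom A w -> inner w d = 0) -> d = 0.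
Proof. by rewrite domE; exact: mult_dom_dense. Qed.

Let commE b v : dom A v ->
  dom A (E (below b) v) /\ act A (E (below b) v) = E (below b) (act A v).
Proof.
move=> Av; split; first exact: (spectral_dom_proj pvmE intE (mbelow b) Av).
exact: (spectral_commute pvmE intE (mbelow b) dense Av).
Qed.

Let dombelow b v : dom A v -> dom A (v - E (below b) v).
Proof.
by move=> /[dup] Av /(commE b)[ABv _]; rewrite addrC -scaleN1r;
  exact: (operator_lin intE (-1) ABv Av).1.
Qed.

Let actB b v : dom A v -> act A (v - E (below b) v) = act A v - E (below b) (act A v).
Proof.
move=> Av; have [ABv cv] := commE b Av.
by rewrite addrC -scaleN1r (operator_lin intE (-1) ABv Av).2 cv scaleN1r addrC.
Qed.

Let vanish_above b v : dom A v ->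
  {ae mu, forall x, 0 < 1 * phi x - b -> repr (E (below b) v) x = 0}.
Proof.
move=> Av; have [ABv _] := commE b Av.
apply: (affine_vanish (P := E (below b)) (oner_neq0 _) _ _ _ _ ABv).
- by move=> c w z; exact: (pvm_lin pvmE _ _ _ (mbelow b)).
- by move=> w; exact: commE.
- move=> w Bw Aw; have := spectral_le pvmE intE Aw Bw; lra.
- exact: (pvm_idem pvmE _ (mbelow b)).
Qed.

Let vanish_below b v : dom A v ->
  {ae mu, forall x, 0 < -1 * phi x + b -> repr (v - E (below b) v) x = 0}.
Proof.
move=> Av.
have EB0 w : E (below b) (w - E (below b) w) = 0.
  by rewrite (pvmB pvmE _ _ (mbelow b)) (pvm_idem pvmE _ (mbelow b)) subrr.
have N1 : -1 != 0 :> R by rewrite oppr_eq0 oner_neq0.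
apply: (affine_vanish (P := fun w => w - E (below b) w) N1 _ _ _ _ (dombelow b Av)).
- move=> c w z; rewrite (pvm_lin pvmE _ _ _ (mbelow b)) scalerBr opprD.
  by rewrite addrACA.
- by move=> w Aw; rewrite actB//; split => //; exact: dombelow.
- move=> w wB Aw; have Bw0 : E (below b) w = 0 by rewrite -wB EB0.
  have := spectral_ge pvmE intE Aw Bw0; lra.
- by rewrite EB0 subr0.
Qed.

(* E ]-oo, b[ v vanishes where phi > b, and v - E ]-oo, b[ v where phi < b; the
   level set phi = b is negligible. *)
Let half_line_on_dom b v : dom A v -> E (below b) v = mult_pvm phi (below b) v.
Proof.
move=> Av; apply/esym; apply: (mult_pvm_eq mphi (mbelow b)).
have h1 := ae_mp2 (fun x p q => conj p q) (vanish_above b Av) (vanish_below b Av).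
have h2 := ae_mp2 (fun x p q => conj p q) (phi_levels b) (repr_lin (-1) (E (below b) v) v).
apply: ae_mp2 h1 h2 => x [h1 h2] [h3 h4].
rewrite indicE; case: (ltgtP (phi x) b) h3 => // pb _.
  rewrite mem_set ?mul1r; last by rewrite /below /= in_itv.
  have : repr (v - E (below b) v) x = 0 by apply: h2; rewrite mulN1r addrC subr_gt0.
  rewrite addrC -scaleN1r h4 mulN1r addrC => /eqP; rewrite subr_eq0 => /eqP ->.
  by [].
rewrite memNset ?mul0r; last by rewrite /below /= in_itv /= lt_gtF.
by apply: h1; rewrite mul1r subr_gt0.
Qed.

(** Both sides are symmetric, everywhere defined and agree on the dense domain. *)
Lemma spectral_half_line (b : R) u : E (below b) u = mult_pvm phi (below b) u.
Proof.
apply/eqP; rewrite -subr_eq0; apply/eqP/dense => w Aw.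
rewrite innerBr -(pvm_sym pvmE _ _ (mbelow b)) -(mult_pvm_sym mphi _ _ (mbelow b)).
by rewrite (half_line_on_dom b Aw) subrr.
Qed.

(** Half lines generate the Borel sets, so the finite measures [<u, E(.) u>] and
    [<u, mult_pvm phi (.) u>] coincide by [spectral_half_line]. *)
Theorem spectral_measure_mult : mult_masses E.
Proof.
move=> u B mB; rewrite -mult_pvm_masses// !spectral_massE//; last first.
  exact: mult_pvm_projection_valued.
have pvmM := mult_pvm_projection_valued mphi.
have key (S : set TR) : measurable S ->
    (mass_measure pvmE u : {measure set TR -> \bar R}) S =
    (mass_measure pvmM u : {measure set TR -> \bar R}) S; last first.
  by rewrite -(mass_measureE pvmE u mB) -(mass_measureE pvmM u mB); exact: key.
have := @measure_unique _ R TR (@RGenInftyO.G R) (fun n => `]-oo, n%:R[%classic)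
  _ _ _ _ (mass_measure pvmE u) (mass_measure pvmM u).
apply => //.
- exact: RGenInftyO.measurableE.
- move=> _ _ [x ->] [z ->]; exists (Order.min x z).
  by apply/seteqP; split => r /=; rewrite !in_itv/= lt_min;
    [move=> [-> ->]|move=> /andP[]].
- by move=> n; exists n%:R.
- apply/seteqP; split => // x _; exists (Num.truncn `|x|).+1 => //=.
  by rewrite in_itv/= (le_lt_trans (ler_norm x))// truncnS_gt.
- move=> _ [b ->]; rewrite (mass_measureE pvmE _ (mbelow b)).
  by rewrite (mass_measureE pvmM _ (mbelow b)) spectral_half_line.
- by move=> n; rewrite (mass_measureE pvmE _ (mbelow n%:R)) ltry.
Qed.

End uniqueness.

(** The functional calculus selects some spectral measure of [A] and some operator
    with the required form; [spectral_measure_mult] and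
    [spectral_integral_acts] make both choices immaterial. *)
Theorem functional_calculus_mult A (psi : R -> C) :
  has_null_levels phi -> cmeasurable psi ->
  acts_as_mult A phiC ->
  acts_as_mult (functional_calculus psi A) (fun x => psi (phi x)).
Proof.
move=> lev mpsi phiA.
have mR : cmeasurable (real_complex R) by apply: cmeasurable_real; exact: measurable_id.
have specM : spectral_measure A (mult_pvm phi).
  split; first exact: mult_pvm_projection_valued.
  apply: mult_spectral_integral => //; exact: mult_pvm_masses.
have ex : exists D, [set D : operator R |
    exists E, spectral_measure A E /\ spectral_integral E psi D] D.
  exists (Operator (mult_dom (fun x => psi (phi x))) (mult (fun x => psi (phi x)))).
  exists (mult_pvm phi); split => //.
  by apply: mult_spectral_integral => //; exact: mult_pvm_masses.
have [E [sE iE]] := xgetPex (Operator set0 id) ex.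
apply: spectral_integral_acts iE => //.
exact: (spectral_measure_mult lev phiA sE).
Qed.

End functional_calculus_of_multiplication.

(** * The operator T in the ground state *)

Section position_operator.
Context {R : realType}.
Local Notation C := R[i].
Local Notation H := (L2 R).
Local Notation TR := (measurableTypeR R).
Local Notation mu := (@lebesgue_measure R).
Implicit Types (u v w : H) (B : set TR) (A : operator R).

Lemma position_mult : acts_as_mult (position R) (fun x => x%:C).
Proof.
have e u : (\int[mu]_x (normc (x%:C * repr u x) ^+ 2)%:E =
    \int[mu]_x (x ^+ 2 * normc (repr u x) ^+ 2)%:E)%E.
  apply: eq_integral => x _; congr EFin.
  by rewrite normcM exprMn [in LHS]Defs.sqr_normc/= expr0n addr0.
split => //; apply/seteqP; split => u /=; last by move=> /sqintP[_]; rewrite e.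
move=> u2; apply/sqintP; rewrite e; split => //.
by apply: cmeasurableM; [exact: cmeasurable_real|exact: repr_cmeasurable].
Qed.

Lemma scale_op_mult (a : R) A (phi : TR -> TR) : a != 0 ->
  measurable_fun setT phi -> acts_as_mult A (fun x => (phi x)%:C) ->
  acts_as_mult (scale_op a%:C A) (fun x => (a * phi x)%:C).
Proof.
move=> a0 mphi [domA actA].
have e u : mult_dom (fun x => (phi x)%:C) u ->
    mult_dom (fun x => (a * phi x)%:C) u /\
    mult (fun x => (a * phi x)%:C) u = a%:C *: mult (fun x => (phi x)%:C) u.
  move=> /(mult_affine a 0 mphi)[]; under eq_fun do rewrite addr0.
  by move=> ? ->; rewrite scale0r addr0.
split => /= [|u Au]; last by rewrite (actA u Au) (e u _).2//= -domA.
rewrite domA; apply/seteqP; split => u /=; first by case/e.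
have maphi : measurable_fun [set: TR] (fun x => a * phi x) by exact: measurable_funM.
move=> /(mult_affine a^-1 0 maphi)[+ _].
by under eq_fun do rewrite addr0 mulKf//.
Qed.

Lemma opT_mult : acts_as_mult (opT R) (fun x => (Num.sqrt 2 * x)%:C).
Proof.
by apply: (@scale_op_mult _ _ id) position_mult => //; rewrite gt_eqF// sqrtr_gt0.
Qed.

Lemma cmeasurable_expi (h : TR -> R) : measurable_fun setT h ->
  cmeasurable (fun x => expi (h x)).
Proof.
move=> mh; split => /=.
  apply: (measurableT_comp _ mh); apply: continuous_measurable_fun.
  exact: continuous_cos.
apply: (measurableT_comp _ mh); apply: continuous_measurable_fun.
exact: continuous_sin.
Qed.

Lemma normc_expi (x : R) : normc (expi x) = 1.
Proof. by rewrite /normc /= cos2Dsin2 sqrtr1. Qed.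

(** Multiplication by a function of modulus 1 is everywhere defined, which puts
    every [u] in the domain of the exponential. *)
Lemma char_fun_mult u A (phi : TR -> TR) t :
  measurable_fun setT phi -> has_null_levels phi ->
  acts_as_mult A (fun x => (phi x)%:C) ->
  char_fun u A t =
  cintegral mu (fun x => expi (t * phi x) * (normc (repr u x) ^+ 2)%:C).
Proof.
move=> mphi lev phiA.
have mpsi : cmeasurable (fun x : R => expi (t * x)).
  by apply: cmeasurable_expi; exact: measurable_funM.
have [domU actU] := functional_calculus_mult mphi lev mpsi phiA.
have mt : cmeasurable (fun x => expi (t * phi x)) by exact: (cmeasurable_comp mpsi).
have dU : mult_dom (fun x => expi (t * phi x)) u.
  by apply: (@mult_dom_bounded _ _ 1) => // x; rewrite normc_expi.
rewrite /char_fun /op_expi actU; last by rewrite domU.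
exact: inner_mult_self.
Qed.

Lemma op_cube_mult A (phi : TR -> TR) :
  measurable_fun setT phi -> has_null_levels phi ->
  acts_as_mult A (fun x => (phi x)%:C) ->
  acts_as_mult (op_cube A) (fun x => (phi x ^+ 3)%:C).
Proof.
move=> mphi lev phiA.
apply: (functional_calculus_mult (psi := fun x => (x ^+ 3)%:C) mphi lev _ phiA).
by apply: cmeasurable_real; exact: measurable_funX.
Qed.

Lemma cube_inj : injective (fun x : R => x ^+ 3).
Proof.
move=> x z /= e; apply/eqP; rewrite -subr_eq0.
have /eqP : (x - z) * (x ^+ 2 + x * z + z ^+ 2) = 0.
  by apply: (etrans (y := x ^+ 3 - z ^+ 3)); [ring|rewrite e subrr].
rewrite mulf_eq0 => /orP[//|/eqP q]; rewrite subr_eq0.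
have z0 : z ^+ 2 = 0.
  by apply/eqP; rewrite eq_le sqr_ge0 andbT; have := sqr_ge0 (2 * x + z); nra.
have x0 : x ^+ 2 = 0.
  by apply/eqP; rewrite eq_le sqr_ge0 andbT; have := sqr_ge0 (2 * z + x); nra.
by move/eqP: z0; move/eqP: x0; rewrite !sqrf_eq0 => /eqP -> /eqP ->.
Qed.

End position_operator.

Section ground_state.
Context {R : realType}.
Local Notation C := R[i].
Local Notation TR := (measurableTypeR R).
Local Notation mu := (@lebesgue_measure R).

(** Lebesgue measure is [a] times its image under dilation by [a]: both give the
    same length to intervals. *)
Lemma ge0_integral_dilation (a : R) (f : TR -> \bar R) : 0 < a ->
  measurable_fun setT f -> (forall x, 0 <= f x)%E ->
  (\int[mu]_x f x = a%:E * \int[mu]_x f (a * x)%R)%E.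
Proof.
move=> a0 mf f0.
have md : measurable_fun [set: TR] (fun x : TR => a * x : TR) by exact: measurable_funM.
pose m : {measure set TR -> \bar R} := mscale (NngNum (ltW a0))
  (measure_function_pushforward__canonical__measure_function_Measure mu md).
have mE (S : set TR) : measurable S -> mu S = m S.
  move=> mS; apply: lebesgue_measure_unique => // _ [[x z]] _ <- /=.
  rewrite /mscale/= /pushforward.
  have -> : (fun y : R => a * y) @^-1` `]x, z] = `]x / a, z / a]%classic.
    apply/seteqP; split => y /=; rewrite !in_itv/= ltr_pdivrMr// ler_pdivlMr//;
    by rewrite (mulrC y).
  rewrite !lebesgue_measure_itv/= !lte_fin ltr_pM2r ?invr_gt0//.
  case: ifP => _; last by rewrite mule0.
  by rewrite -EFinD -EFinM -mulrBl mulrCA divff ?mulr1// gt_eqF.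
rewrite (eq_measure_integral m) => [|S mS _]; last exact: mE.
rewrite ge0_integral_mscale//; congr (_ * _)%E.
by rewrite (ge0_integral_pushforward md)// preimage_setT.
Qed.

Let w (x : R) : R := (pi `^ (- 4^-1) * expR (- (x ^+ 2 / 2))) ^+ 2.

Let wE x : w x = (Num.sqrt pi)^-1 * gauss_fun x.
Proof.
rewrite /w exprMn -expRM_natl /gauss_fun; congr (_ * expR _); last by field.
rewrite -powR_mulrn ?powR_ge0// -powRrM (_ : - 4^-1 * 2%:R = - 2^-1); last by field.
by rewrite powRN powR12_sqrt// pi_ge0.
Qed.

Let w_ge0 x : 0 <= w x. Proof. exact: sqr_ge0. Qed.

Let mw : measurable_fun [set: TR] w.
Proof.
rewrite (_ : w = fun x => (Num.sqrt pi)^-1 * gauss_fun x); last exact/funext.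
by apply: measurable_funM => //; exact: measurable_gauss_fun.
Qed.

Let iw : (\int[mu]_x (w x)%:E < +oo)%E.
Proof.
under eq_integral do rewrite wE EFinM.
rewrite integralZl//; last exact: integrableT_gauss.
by rewrite integralT_gauss -EFinM ltry.
Qed.

Lemma Phi_repr : {ae mu, forall x, normc (repr (Phi R) x) ^+ 2 = w x}.
Proof.
have nE x : normc (pi `^ (- 4^-1) * expR (- (x ^+ 2 / 2)))%:C ^+ 2 = w x.
  by rewrite Defs.sqr_normc/= expr0n addr0.
have sq : square_integrable
    (fun x : R => (pi `^ (- 4^-1) * expR (- (x ^+ 2 / 2)))%:C).
  apply/sqintP; split; last by under eq_integral do rewrite nE.
  apply: cmeasurable_real; apply: measurable_funM => //.
  apply: measurableT_comp => //; apply: measurableT_comp => //.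
  by apply: measurable_funM => //; exact: measurable_funX.
by apply: ae_mp (repr_L2_class sq) => x ->.
Qed.

Let normal_probE (B : set TR) : measurable B ->
  normal_prob 0 1 B = (\int[mu]_(x in (fun x => (Num.sqrt 2 * x)%R) @^-1` B) (w x)%:E)%E.
Proof.
move=> mB; rewrite /normal_prob integral_mkcond [RHS]integral_mkcond.
have s2 : 0 < Num.sqrt 2 :> R by rewrite sqrtr_gt0.
have mpdf : measurable_fun [set: TR] (fun x : R => (normal_pdf 0 1 x)%:E).
  by apply/measurable_EFinP; exact: measurable_normal_pdf.
have mpB : measurable_fun [set: TR] ((fun x : R => (normal_pdf 0 1 x)%:E) \_ B).
  by apply/(measurable_restrictT _ _).1 => //; exact: measurable_funTS.
have p0 x : (0 <= ((fun x : R => (normal_pdf 0 1 x)%:E) \_ B) x)%E.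
  by apply: erestrict_ge0 => ? _; rewrite lee_fin normal_pdf_ge0.
rewrite (ge0_integral_dilation s2 mpB p0).
have md : measurable_fun [set: TR] (fun x : TR => Num.sqrt 2 * x : TR).
  exact: measurable_funM.
rewrite -(@ge0_integralZl _ TR R mu setT measurableT _ (measurableT_comp mpB md));
  last 2 first.
- by move=> x _; exact: p0.
- by rewrite lee_fin ltW.
apply: eq_integral => x _; rewrite /comp !patchE -[x \in _]/(Num.sqrt 2 * x \in B).
case: ifP => _; last by rewrite mule0.
rewrite -EFinM wE normal_pdfE ?oner_neq0// /normal_peak /normal_fun /gauss_fun.
rewrite subr0 expr1n mul1r exprMn sqr_sqrtr// -(mulr_natr pi 2) (sqrtrM _ (pi_ge0 R)).
rewrite invfM mulrA mulrA; congr EFin; congr (_ * expR _); last by field.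
by field; rewrite !gt_eqF// sqrtr_gt0 pi_gt0.
Qed.

(** The density [pi^(-1/2) e^(-x^2)] of [|Phi|^2] is Gaussian of variance 1/2, and
    the dilation by [sqrt 2] makes the variance 1. *)
Lemma ground_state_law (h : R -> C) : cmeasurable h ->
  cintegral mu (fun x => h (Num.sqrt 2 * x) * (normc (repr (Phi R) x) ^+ 2)%:C) =
  cintegral (normal_prob 0 1) h.
Proof.
move=> mh; have ms : measurable_fun [set: TR] (fun x : TR => Num.sqrt 2 * x : TR).
  exact: measurable_funM.
have mhs : cmeasurable (fun x => h (Num.sqrt 2 * x)) by exact: cmeasurable_comp.
transitivity (cintegral mu (fun x => h (Num.sqrt 2 * x) * (w x)%:C)).
  apply: ae_eq_cintegral; last by apply: ae_mp Phi_repr => x ->.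
    apply: cmeasurableM => //; apply: cmeasurable_real.
    by apply: measurable_normc2; exact: repr_cmeasurable.
  by apply: cmeasurableM => //; exact: cmeasurable_real.
by rewrite (cintegral_law mw w_ge0 iw ms normal_probE).
Qed.

End ground_state.

Section characteristic_functions.
Context {R : realType}.

Lemma char_fun_T (t : R) : char_fun (Phi R) (opT R) t =
  cintegral (normal_prob 0 1) (fun x => expi (t * x)).
Proof.
rewrite (@char_fun_mult _ _ _ (fun x => Num.sqrt 2 * x))//; last 3 first.
- exact: measurable_funM.
- apply: injective_null_levels; apply: mulfI.
  by rewrite gt_eqF// sqrtr_gt0.
- exact: opT_mult.
rewrite -ground_state_law//; apply: cmeasurable_expi; exact: measurable_funM.
Qed.

Lemma char_fun_T3 (t : R) : char_fun (Phi R) (op_cube (opT R)) t =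
  cintegral (normal_prob 0 1) (fun x => expi (t * x ^+ 3)).
Proof.
have s0 : Num.sqrt 2 != 0 :> R by rewrite gt_eqF// sqrtr_gt0.
have ms : measurable_fun [set: measurableTypeR R]
   (fun x : measurableTypeR R => Num.sqrt 2 * x) by exact: measurable_funM.
have levT : has_null_levels (fun x : R => Num.sqrt 2 * x).
  by apply: injective_null_levels; exact: mulfI.
rewrite (@char_fun_mult _ _ _ (fun x => (Num.sqrt 2 * x) ^+ 3))//; last 3 first.
- exact: measurable_funX.
- apply: injective_null_levels; apply: (inj_comp cube_inj); exact: mulfI.
- exact: (op_cube_mult ms levT opT_mult).
rewrite -ground_state_law//; apply: cmeasurable_expi; exact: measurable_funM.
Qed.

End characteristic_functions.

(** * Derivatives and integrals of derivatives on the line *)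

Section pointwise_derivatives.
Context {R : realType}.
Implicit Types (f g : R -> R) (x : R).

(** Derivatives of explicit expressions are assembled from the rules below, stated
    for functions written as abstractions; [der_eq] then puts the value of the
    derivative in the desired form. *)
Lemma der_eq f x d d' : is_derive x 1 f d -> d = d' -> is_derive x 1 f d'.
Proof. by move=> h <-. Qed.

Lemma der_cst (c : R) x : is_derive x 1 (fun=> c) 0.
Proof. exact: is_derive_cst. Qed.

Lemma der_id x : is_derive x 1 (fun y : R => y) 1.
Proof. exact: is_derive_id. Qed.

Lemma derD f g x df dg : is_derive x 1 f df -> is_derive x 1 g dg ->
  is_derive x 1 (fun y => f y + g y) (df + dg).
Proof. by move=> hf hg; exact: is_deriveD. Qed.

Lemma derB f g x df dg : is_derive x 1 f df -> is_derive x 1 g dg ->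
  is_derive x 1 (fun y => f y - g y) (df - dg).
Proof. by move=> hf hg; exact: is_deriveB. Qed.

Lemma derN f x df : is_derive x 1 f df -> is_derive x 1 (fun y => - f y) (- df).
Proof. by move=> hf; exact: is_deriveN. Qed.

Lemma derM f g x df dg : is_derive x 1 f df -> is_derive x 1 g dg ->
  is_derive x 1 (fun y => f y * g y) (df * g x + f x * dg).
Proof.
move=> hf hg; apply: (der_eq (is_deriveM hf hg)).
by rewrite /GRing.scale/=; ring.
Qed.

Lemma derX f n x df : is_derive x 1 f df ->
  is_derive x 1 (fun y => f y ^+ n.+1) (n.+1%:R * f x ^+ n * df).
Proof.
move=> hf.
rewrite (_ : (fun y => f y ^+ n.+1) = f ^+ n.+1); last by rewrite exprfctE.
apply: (der_eq (is_deriveX n.+1 hf)).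
by rewrite /GRing.scale/= mulr_natl.
Qed.

Lemma der_comp f g x df dg : is_derive (g x) 1 f df -> is_derive x 1 g dg ->
  is_derive x 1 (fun y => f (g y)) (df * dg).
Proof. by move=> hf hg; apply: (der_eq (is_derive1_comp hf hg)). Qed.

Lemma der_exp f x df : is_derive x 1 f df ->
  is_derive x 1 (fun y => expR (f y)) (expR (f x) * df).
Proof. by apply: der_comp; exact: is_derive_expR. Qed.

Lemma der_sin f x df : is_derive x 1 f df ->
  is_derive x 1 (fun y => sin (f y)) (cos (f x) * df).
Proof. by apply: der_comp; exact: is_derive_sin. Qed.

Lemma der_cos f x df : is_derive x 1 f df ->
  is_derive x 1 (fun y => cos (f y)) (- sin (f x) * df).
Proof. by apply: der_comp; exact: is_derive_cos. Qed.

Lemma der_sqrt f x df : 0 < f x -> is_derive x 1 f df ->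
  is_derive x 1 (fun y => Num.sqrt (f y)) ((2 * Num.sqrt (f x))^-1 * df).
Proof. by move=> f0; apply: der_comp; exact: is_derive1_sqrt. Qed.

Lemma der_ln f x df : 0 < f x -> is_derive x 1 f df ->
  is_derive x 1 (fun y => ln (f y)) ((f x)^-1 * df).
Proof. by move=> f0; apply: der_comp; exact: is_derive1_ln. Qed.

Lemma der_continuous f df : (forall x, is_derive x 1 f (df x)) -> continuous f.
Proof.
move=> h x; apply: differentiable_continuous; apply/derivable1_diffP.
by case: (h x).
Qed.

Lemma derive1_der f x d : is_derive x 1 f d -> derive1 f x = d.
Proof. by move=> h; rewrite derive1E derive_val. Qed.

Lemma contM f g : continuous f -> continuous g -> continuous (fun x => f x * g x).
Proof. by move=> cf cg x; apply: cvgM; [exact: cf|exact: cg]. Qed.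

Lemma contD f g : continuous f -> continuous g -> continuous (fun x => f x + g x).
Proof. by move=> cf cg x; apply: cvgD; [exact: cf|exact: cg]. Qed.

Lemma contN f : continuous f -> continuous (fun x => - f x).
Proof. by move=> cf x; apply: cvgN; exact: cf. Qed.

Lemma contV f : (forall x, f x != 0) -> continuous f -> continuous (fun x => (f x)^-1).
Proof. by move=> f0 cf x; apply: cvgV => //; exact: cf. Qed.

Lemma cont_comp f g : continuous f -> continuous g -> continuous (fun x => f (g x)).
Proof. by move=> cf cg x; apply: continuous_comp; [exact: cg|exact: cf]. Qed.

End pointwise_derivatives.

Section integral_of_derivative.
Context {R : realType}.
Local Notation TR := (measurableTypeR R).
Local Notation mu := (@lebesgue_measure R).

(** The integral from [- n] to [n] is [V n - V (- n)], and it converges to the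
    integral over the line by dominated convergence. *)
Lemma integral_derivative_eq0 (V W : R -> R) :
  (forall x : R, is_derive x 1 V (W x)) -> continuous W ->
  mu.-integrable setT (EFin \o W) ->
  V n.+1%:R - V (- n.+1%:R) @[n --> \oo] --> 0 ->
  (\int[mu]_x (W x)%:E = 0)%E.
Proof.
move=> dV cW iW lim0.
have cV := der_continuous dV.
have ftc n : (\int[mu]_(x in `[(- n.+1%:R)%R, n.+1%:R%R]) (W x)%:E =
    (V n.+1%:R%R - V (- n.+1%:R)%R)%R%:E)%E.
  rewrite (@continuous_FTC2 _ W V) ?EFinB//.
  - have : (0 : R) < n.+1%:R by [].
    by lra.
  - exact: continuous_subspaceT.
  - split=> [x _||]; first by case: (dV x).
    + by apply: cvg_at_right_filter; exact: cV.
    + by apply: cvg_at_left_filter; exact: cV.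
  - by move=> x _; exact: derive1_der.
have mW : measurable_fun [set: TR] (EFin \o W) by exact: measurable_int iW.
pose f n := ((EFin \o W) \_ (`[- n.+1%:R, n.+1%:R] : set TR)).
have [] := @dominated_convergence _ TR R mu setT measurableT f (EFin \o W)
  (abse \o (EFin \o W)).
- by move=> n; apply/(measurable_restrictT _ _).1 => //; exact: measurable_funTS.
- by [].
- apply: aeW => x _; apply: cvg_near_cst; near=> n.
  rewrite /f patchE mem_set//= in_itv/= -ler_norml.
  apply: ltW; rewrite (lt_trans (truncnS_gt _))// ltr_nat ltnS.
  by near: n; exact: nbhs_infty_gt.
- exact: integrable_abse.
- apply: aeW => x n _ /=; rewrite /f patchE.
  by case: ifP => // _; rewrite abse0.
move=> _ _; rewrite (_ : [sequence _]_n = fun n => (V n.+1%:R - V (- n.+1%:R))%:E).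
  move=> /cvg_lim <-//; apply/cvg_lim => //.
  by apply/fine_cvgP; split; [exact: nearW|exact: lim0].
by apply/funext => n /=; rewrite -ftc [RHS]integral_mkcond.
Unshelve. all: by end_near. Qed.

End integral_of_derivative.

(** * Deformation of the line of integration *)

Section contour.
Context {R : realType}.
Local Notation TR := (measurableTypeR R).
Local Notation mu := (@lebesgue_measure R).
Variable t : R.
Hypothesis t0 : 0 < t.
Implicit Types (x y th : R).

(** Real and imaginary part of i t z^3 - z^2 / 2 at z = x + i y. *)
Definition phase_re x y : R := t * y ^+ 3 - 3 * t * x ^+ 2 * y - (x ^+ 2 - y ^+ 2) / 2.
Definition phase_im x y : R := t * (x ^+ 3 - 3 * x * y ^+ 2) - x * y.

(* P + i Q is the derivative 3 i t z^2 - z of the exponent: the Cauchy-Riemann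
   equations make it govern all partial derivatives below. *)
Let P x y : R := - (6 * t * x * y + x).
Let Q x y : R := 3 * t * (x ^+ 2 - y ^+ 2) - y.

Lemma der_phase_re (X Y : R -> R) (s dX dY : R) :
  is_derive s 1 X dX -> is_derive s 1 Y dY ->
  is_derive s 1 (fun r => phase_re (X r) (Y r))
    (P (X s) (Y s) * dX - Q (X s) (Y s) * dY).
Proof.
move=> hX hY; apply: (der_eq (derB
  (derB (derM (der_cst t s) (derX 2 hY))
        (derM (derM (der_cst (3 * t) s) (derX 1 hX)) hY))
  (derM (derB (derX 1 hX) (derX 1 hY)) (der_cst 2^-1 s)))).
by rewrite /P /Q /=; field.
Qed.

Lemma der_phase_im (X Y : R -> R) (s dX dY : R) :
  is_derive s 1 X dX -> is_derive s 1 Y dY ->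
  is_derive s 1 (fun r => phase_im (X r) (Y r))
    (Q (X s) (Y s) * dX + P (X s) (Y s) * dY).
Proof.
move=> hX hY; apply: (der_eq (derB
  (derM (der_cst t s)
     (derB (derX 2 hX) (derM (derM (der_cst 3 s) hX) (derX 1 hY))))
  (derM hX hY))).
by rewrite /P /Q /=; ring.
Qed.

(** The imaginary part of the exponent is [x (t x^2 - 3 t y^2 - y)]. It vanishes on
    the path of steepest descent, whose height over [x] is the nonnegative root
    [y] of the quadratic factor; the radical is that of its discriminant. *)
Definition descent_radical x : R := Num.sqrt (1 + 12 * t ^+ 2 * x ^+ 2).
Local Notation S := descent_radical.
Definition descent_height x : R := (S x - 1) / (6 * t).
Local Notation Y := descent_height.
Let Y' x : R := 2 * t * x / S x.

Let S2_gt0 x : 0 < 1 + 12 * t ^+ 2 * x ^+ 2.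
Proof. by have := sqr_ge0 (t * x); rewrite exprMn; lra. Qed.

Lemma descent_radical_gt0 x : 0 < S x. Proof. by rewrite sqrtr_gt0. Qed.

Lemma sqr_descent_radical x : S x ^+ 2 = 1 + 12 * t ^+ 2 * x ^+ 2.
Proof. by rewrite sqr_sqrtr// ltW. Qed.

Lemma descent_radical_ge1 x : 1 <= S x.
Proof.
rewrite -(@ler_sqr _ 1) ?nnegrE ?(ltW (descent_radical_gt0 x))//.
rewrite sqr_descent_radical expr1n lerDl.
by have := sqr_ge0 (t * x); rewrite exprMn; lra.
Qed.

Lemma descent_height_ge0 x : 0 <= Y x.
Proof.
rewrite /descent_height mulr_ge0 ?invr_ge0 ?subr_ge0 ?descent_radical_ge1//.
by rewrite mulr_ge0// ltW.
Qed.

Lemma descent_height_eq x : t * x ^+ 2 = 3 * t * Y x ^+ 2 + Y x.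
Proof.
have -> : x ^+ 2 = (S x ^+ 2 - 1) / (12 * t ^+ 2).
  by rewrite sqr_descent_radical; field; rewrite gt_eqF.
by rewrite /descent_height; field; rewrite gt_eqF.
Qed.

Lemma sqr_descent_height_le x : Y x ^+ 2 <= x ^+ 2 / 3.
Proof.
rewrite ler_pdivlMr// -(ler_pM2l t0) descent_height_eq; have := descent_height_ge0 x; lra.
Qed.

Lemma descent_height_le x : Y x <= `|x|.
Proof.
rewrite -(@ler_sqr _ (Y x)) ?nnegrE ?descent_height_ge0// real_normK ?num_real//.
by have := sqr_descent_height_le x; have := sqr_ge0 x; lra.
Qed.

Let Y'_le x : `|Y' x| <= 1.
Proof.
rewrite /Y' normrM normfV (gtr0_norm (descent_radical_gt0 x)).
rewrite ler_pdivrMr ?descent_radical_gt0// mul1r.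
rewrite -(@ler_sqr _ `|2 * t * x|) ?nnegrE ?(ltW (descent_radical_gt0 x))//.
rewrite real_normK ?num_real// sqr_descent_radical !exprMn.
by have := sqr_ge0 (t * x); rewrite exprMn; lra.
Qed.

Lemma der_descent_radical x : is_derive x 1 S (12 * t ^+ 2 * x / S x).
Proof.
have d := derD (der_cst 1 x) (derM (der_cst (12 * t ^+ 2) x) (derX 1 (der_id x))).
apply: (der_eq (der_sqrt (f := fun x => 1 + 12 * t ^+ 2 * x ^+ 2) (S2_gt0 x) d)).
by rewrite -/(S x) /=; field; rewrite gt_eqF// descent_radical_gt0.
Qed.

Lemma der_descent_height x : is_derive x 1 Y (Y' x).
Proof.
apply: (der_eq (derM (derB (der_descent_radical x) (der_cst 1 x)) (der_cst (6 * t)^-1 x))).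
by rewrite /Y'; field; rewrite !gt_eqF// descent_radical_gt0.
Qed.

(** Between the real axis and the path one has [y^2 <= x^2 / 3], which leaves a
    Gaussian decay. *)
Lemma phase_re_le x y : 0 <= y -> y <= Y x -> phase_re x y <= - (x ^+ 2 / 3).
Proof.
move=> y0 yY; have y2 : y ^+ 2 <= x ^+ 2 / 3.
  by apply: le_trans (sqr_descent_height_le x); rewrite ler_sqr ?nnegrE ?descent_height_ge0.
have ty : 0 <= t * y by rewrite mulr_ge0// ltW.
have := mulr_ge0 ty (sqr_ge0 x); have := ler_wpM2l ty y2; have := sqr_ge0 x.
by rewrite /phase_re; lra.
Qed.

(* The paths x + i (l th) (Y x) join the real axis, at th = 0, to the path of
   steepest descent, at th = pi / 2. With a periodic l the estimates hold for all
   real th, so no boundary times have to be treated. *)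
Let l th : R := sin th ^+ 2.
Let l' th : R := 2 * sin th * cos th.

Let der_l th : is_derive th 1 l (l' th).
Proof.
apply: (der_eq (derX 1 (der_sin (der_id th)))).
by rewrite /l' /=; ring.
Qed.

Let l_ge0 th : 0 <= l th. Proof. exact: sqr_ge0. Qed.

Let l_le1 th : l th <= 1.
Proof. by have := cos2Dsin2 th; have := sqr_ge0 (cos th); rewrite /l; lra. Qed.

Let l'_le th : `|l' th| <= 1.
Proof.
rewrite ler_norml /l'; have := cos2Dsin2 th.
have := sqr_ge0 (cos th - sin th); have := sqr_ge0 (cos th + sin th).
by move=> h1 h2 h3; apply/andP; split; nra.
Qed.

Let y th x : R := l th * Y x.

(** The real part of [e^phase dz/dx] along the path at time [th]. *)
Definition contour_integrand th x : R :=
  expR (phase_re x (y th x)) *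
  (cos (phase_im x (y th x)) - sin (phase_im x (y th x)) * (l th * Y' x)).
Local Notation U := contour_integrand.

(* V is the real part of e^phase dz/dth. As the exponential of the phase is
   holomorphic, the derivative of U in th is that of V in x; both are W. *)
Let V th x : R :=
  - (expR (phase_re x (y th x)) * sin (phase_im x (y th x)) * (l' th * Y x)).
Let W th x : R :=
  - (expR (phase_re x (y th x)) *
     (((P x (y th x) - Q x (y th x) * (l th * Y' x)) * (l' th * Y x) + l' th * Y' x)
        * sin (phase_im x (y th x)) +
      (Q x (y th x) + P x (y th x) * (l th * Y' x)) * (l' th * Y x)
        * cos (phase_im x (y th x)))).

Let der_y_th th x : is_derive th 1 (fun s => y s x) (l' th * Y x).
Proof.
apply: (der_eq (derM (der_l th) (der_cst (Y x) th))).
by rewrite mulr0 addr0.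
Qed.

Let der_y_x th x : is_derive x 1 (y th) (l th * Y' x).
Proof.
apply: (der_eq (derM (der_cst (l th) x) (der_descent_height x))).
by rewrite mul0r add0r.
Qed.

Let der_U th x : is_derive th 1 (fun s => U s x) (W th x).
Proof.
have da := der_phase_re (der_cst x th) (der_y_th th x).
have db := der_phase_im (der_cst x th) (der_y_th th x).
apply: (der_eq (derM (der_exp da) (derB (der_cos db)
  (derM (der_sin db) (derM (der_l th) (der_cst (Y' x) th)))))).
by rewrite /W; ring.
Qed.

Let der_V th x : is_derive x 1 (V th) (W th x).
Proof.
have da := der_phase_re (der_id x) (der_y_x th x).
have db := der_phase_im (der_id x) (der_y_x th x).
apply: (der_eq (derN (derM (derM (der_exp da) (der_sin db))
  (derM (der_cst (l' th) x) (der_descent_height x))))).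
by rewrite /W; ring.
Qed.

Let y_ge0 th x : 0 <= y th x. Proof. by rewrite mulr_ge0// descent_height_ge0. Qed.

Let y_le th x : y th x <= Y x.
Proof. by rewrite -[leRHS]mul1r ler_wpM2r// descent_height_ge0. Qed.

Let expa_le th x : expR (phase_re x (y th x)) <= expR (- (x ^+ 2 / 3)).
Proof. by rewrite ler_expR phase_re_le. Qed.

Let gauss6 x : R := expR (- (x ^+ 2 / 6)).

(* 144 = 12^2 comes from 1 + a <= 12 (1 + a / 12) <= 12 e^(a / 12), a = x^2. *)
Let poly_gauss x : (1 + x ^+ 2) ^+ 2 * expR (- (x ^+ 2 / 3)) <= 144 * gauss6 x.
Proof.
have e : expR (- (x ^+ 2 / 3)) = gauss6 x * gauss6 x.
  by rewrite /gauss6 -expRD; congr expR; field.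
rewrite e mulrA ler_wpM2r ?expR_ge0//.
have e2 : gauss6 x = expR (x ^+ 2 / 12) ^- 2.
  by rewrite /gauss6 expRN -expRM_natl; congr (expR _)^-1; field.
rewrite e2 ler_pdivrMr ?exprn_gt0 ?expR_gt0//.
have : (1 + x ^+ 2 / 12) ^+ 2 <= expR (x ^+ 2 / 12) ^+ 2.
  rewrite ler_sqr ?nnegrE ?expR_ge0 ?expR_ge1Dx//.
  by rewrite addr_ge0// divr_ge0// sqr_ge0.
have := sqr_ge0 x; move: (x ^+ 2) (expR _ ^+ 2) => a b a0 h; nra.
Qed.

Let integrable_gauss6 : mu.-integrable setT (EFin \o gauss6).
Proof.
have s3 : Num.sqrt 3 != 0 :> R by rewrite gt_eqF// sqrtr_gt0.
have i := @integrable_normal_pdf R 0 (Num.sqrt 3).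
have := @integrableZl _ TR R mu setT measurableT (normal_peak (Num.sqrt 3 : R))^-1 _ i.
apply: eq_integrable => // x _ /=; rewrite normal_pdfE// -EFinM mulKf; last first.
  by rewrite gt_eqF// normal_peak_gt0.
rewrite /normal_fun /gauss6 subr0 sqr_sqrtr//.
by congr (expR _)%:E; field.
Qed.

Let P_le th x : `|P x (y th x)| <= 6 * t * x ^+ 2 + `|x|.
Proof.
have yx : `|y th x| <= `|x|.
  by rewrite ger0_norm// (le_trans (y_le th x))// descent_height_le.
rewrite /P normrN (le_trans (ler_normD _ _))// lerD2r -mulrA normrM.
have t6 : 0 <= 6 * t by rewrite mulr_ge0// ltW.
rewrite (ger0_norm t6) ler_wpM2l// normrM -(real_normK (num_real x)).
by rewrite expr2 ler_wpM2l.
Qed.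

Let Q_le th x : `|Q x (y th x)| <= 3 * t * x ^+ 2 + `|x|.
Proof.
have yx : `|y th x| <= `|x|.
  by rewrite ger0_norm// (le_trans (y_le th x))// descent_height_le.
rewrite /Q (le_trans (ler_normB _ _))// lerD// normrM.
have t3 : 0 <= 3 * t by rewrite mulr_ge0// ltW.
rewrite (ger0_norm t3) ler_wpM2l//.
have : y th x ^+ 2 <= x ^+ 2.
  by rewrite -(real_normK (num_real x)) -(real_normK (num_real (y th x))) ler_sqr ?nnegrE.
have := sqr_ge0 (y th x); rewrite ler_norml; move: (y th x ^+ 2) (x ^+ 2) => a b.
by move=> a0 ab; apply/andP; split; lra.
Qed.

Let norm_sin_le1 (b : R) : `|sin b| <= 1.
Proof. by rewrite ler_norml sin_geN1 sin_le1. Qed.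

Let norm_cos_le1 (b : R) : `|cos b| <= 1.
Proof. by rewrite ler_norml cos_geN1 cos_le1. Qed.

Let prod_le1 (a b : R) : `|a| <= 1 -> `|b| <= 1 -> `|a * b| <= 1.
Proof. by move=> a1 b1; rewrite normrM mulr_ile1. Qed.

Let norm_l_le1 th : `|l th| <= 1. Proof. by rewrite ger0_norm. Qed.

Let poly_le (r c : R) : 0 <= c -> 0 <= r ->
  2 * (9 * c * r ^+ 2 + 2 * r) * r + 1 <= (18 * c + 4) * (1 + r ^+ 2) ^+ 2.
Proof.
move=> c0 r0; have h : r ^+ 3 <= (1 + r ^+ 2) ^+ 2.
  have := mulr_ge0 r0 (sqr_ge0 (r - 1)); have := sqr_ge0 (r ^+ 2 - r).
  by have := sqr_ge0 r; have := sqr_ge0 (r - 1); nra.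
have h4 : 4 * r ^+ 2 + 1 <= 4 * (1 + r ^+ 2) ^+ 2.
  by have := sqr_ge0 r; have := sqr_ge0 (r ^+ 2); nra.
by have := ler_wpM2l c0 h; nra.
Qed.

Let norm_addM_le (a b k : R) : `|k| <= 1 -> `|a + b * k| <= `|a| + `|b|.
Proof.
move=> k1; rewrite (le_trans (ler_normD _ _))// lerD2l normrM.
by rewrite -[leRHS]mulr1 ler_wpM2l.
Qed.

(* The second factor of W, with p, q, k, D, m, s, c in place of P, Q, l Y', l' Y,
   l' Y', sin, cos. *)
Let bracket_le (p q k D m s c r : R) :
  `|k| <= 1 -> `|D| <= r -> `|m| <= 1 -> `|s| <= 1 -> `|c| <= 1 ->
  `|((p - q * k) * D + m) * s + (q + p * k) * D * c| <=
    2 * (`|p| + `|q|) * r + 1.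
Proof.
move=> k1 Dr m1 s1 c1.
have h1 : `|(p - q * k) * D + m| <= (`|p| + `|q|) * r + 1.
  rewrite (le_trans (ler_normD _ _))// lerD// normrM ler_pM//.
  by rewrite -mulNr -(normrN q) norm_addM_le.
have h2 : `|(q + p * k) * D| <= (`|p| + `|q|) * r.
  by rewrite normrM ler_pM// [leRHS]addrC norm_addM_le.
rewrite (le_trans (norm_addM_le _ _ c1))//.
rewrite [leRHS](_ : _ = ((`|p| + `|q|) * r + 1) + (`|p| + `|q|) * r); last by ring.
rewrite lerD// normrM (le_trans _ h1)// -[leRHS]mulr1 ler_wpM2l//.
Qed.

Let W_le th x : `|W th x| <= 144 * (18 * t + 4) * gauss6 x.
Proof.
have Dx : `|l' th * Y x| <= `|x|.
  rewrite normrM -[leRHS]mul1r ler_pM// (ger0_norm (descent_height_ge0 x)).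
  exact: descent_height_le.
have k1 := prod_le1 (norm_l_le1 th) (Y'_le x).
have m1 := prod_le1 (l'_le th) (Y'_le x).
have h := bracket_le (P x (y th x)) (Q x (y th x)) k1 Dx m1
  (norm_sin_le1 (phase_im x (y th x))) (norm_cos_le1 (phase_im x (y th x))).
rewrite /W normrN normrM ger0_norm ?expR_ge0//.
apply: le_trans (ler_pM _ _ (expa_le th x) h) _; rewrite ?expR_ge0//.
have pq : 2 * (`|P x (y th x)| + `|Q x (y th x)|) * `|x| + 1 <=
    (18 * t + 4) * (1 + `|x| ^+ 2) ^+ 2.
  apply: le_trans (poly_le (ltW t0) (normr_ge0 x)).
  rewrite lerD2r ler_wpM2r// ler_wpM2l// real_normK ?num_real//.
  by have := P_le th x; have := Q_le th x; lra.
rewrite real_normK ?num_real// in pq.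
apply: le_trans (ler_wpM2l (expR_ge0 _) pq) _.
rewrite mulrCA -[leRHS]mulrA [leRHS]mulrCA ler_wpM2l//.
  by rewrite addr_ge0// mulr_ge0// ltW.
by rewrite [leLHS]mulrC poly_gauss.
Qed.

Let U_le th x : `|U th x| <= 288 * gauss6 x.
Proof.
have k1 := prod_le1 (norm_l_le1 th) (Y'_le x).
have h : `|cos (phase_im x (y th x)) - sin (phase_im x (y th x)) * (l th * Y' x)| <= 2.
  rewrite -mulNr (le_trans (norm_addM_le _ _ k1))// normrN.
  have := norm_sin_le1 (phase_im x (y th x)).
  by have := norm_cos_le1 (phase_im x (y th x)); lra.
rewrite /contour_integrand normrM ger0_norm ?expR_ge0//.
apply: le_trans (ler_pM _ _ (expa_le th x) h) _; rewrite ?expR_ge0//.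
have := poly_gauss x; have : 1 <= (1 + x ^+ 2) ^+ 2.
  by have := sqr_ge0 x; have := sqr_ge0 (x ^+ 2); lra.
by move=> /(ler_wpM2r (expR_ge0 (- (x ^+ 2 / 3)))); lra.
Qed.

Let contS : continuous S. Proof. exact: der_continuous der_descent_radical. Qed.
Let contY : continuous Y. Proof. exact: der_continuous der_descent_height. Qed.

Let cont_cst (c : R) : continuous (fun _ : R => c). Proof. exact: cst_continuous. Qed.

Let cont_id : continuous (fun x : R => x). Proof. by move=> x; exact: cvg_id. Qed.

Let contY' : continuous Y'.
Proof.
apply: contM; first by apply: contM; [exact: cont_cst|exact: cont_id].
by apply: contV => [x|]; [rewrite gt_eqF// descent_radical_gt0|exact: contS].
Qed.

Let conty th : continuous (y th).
Proof. by apply: contM; [exact: cont_cst|exact: contY]. Qed.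

Let contX (f : R -> R) n : continuous f -> continuous (fun x => f x ^+ n).
Proof.
move=> cf; elim: n => [|n ih]; first exact: cont_cst.
by under eq_fun do rewrite exprS; exact: contM.
Qed.

Let cont_re th : continuous (fun x => phase_re x (y th x)).
Proof. exact: der_continuous (fun x => der_phase_re (der_id x) (der_y_x th x)). Qed.

Let cont_im th : continuous (fun x => phase_im x (y th x)).
Proof. exact: der_continuous (fun x => der_phase_im (der_id x) (der_y_x th x)). Qed.

Let cont_exp th : continuous (fun x => expR (phase_re x (y th x))).
Proof. by apply: (cont_comp (f := expR)) => //; exact: continuous_expR. Qed.

Let cont_sin th : continuous (fun x => sin (phase_im x (y th x))).
Proof. by apply: (cont_comp (f := sin)) => //; exact: continuous_sin. Qed.

Let cont_cos th : continuous (fun x => cos (phase_im x (y th x))).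
Proof. by apply: (cont_comp (f := cos)) => //; exact: continuous_cos. Qed.

Let cont_lY' th : continuous (fun x => l th * Y' x).
Proof. exact: contM. Qed.

Let contP th : continuous (fun x => P x (y th x)).
Proof. by apply: contN; apply: contD => //; do 2![apply: contM => //]. Qed.

Let contQ th : continuous (fun x => Q x (y th x)).
Proof.
apply: contD; last exact: contN.
by apply: contM => //; apply: contD; [|apply: contN]; exact: contX.
Qed.

Let contU th : continuous (U th).
Proof.
apply: contM => //; apply: contD => //; apply: contN; exact: contM.
Qed.

Let contW th : continuous (W th).
Proof.
apply: contN; apply: contM => //; apply: contD.
  apply: contM => //; apply: contD; last exact: contM.
  apply: contM; last exact: contM.
  by apply: contD => //; apply: contN; exact: contM.
apply: contM => //; apply: contM; last exact: contM.
by apply: contD => //; exact: contM.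
Qed.

Let dominated_integrable (f : R -> R) (M : R) : continuous f ->
  (forall x, `|f x| <= M * gauss6 x) -> mu.-integrable setT (EFin \o f).
Proof.
move=> cf fM; apply: (@le_integrable _ TR R mu setT measurableT _
  (fun x => (M%:E * (gauss6 x)%:E)%E)).
- by apply/measurable_EFinP; exact: continuous_measurable_fun.
- by move=> x _ /=; rewrite lee_fin (le_trans (fM x))// ler_norm.
- exact: integrableZl.
Qed.

Lemma integrable_contour_integrand th : mu.-integrable setT (EFin \o U th).
Proof. exact: dominated_integrable (U_le th). Qed.

Let integrable_W th : mu.-integrable setT (EFin \o W th).
Proof. exact: dominated_integrable (W_le th). Qed.

Let V_le th x : `|V th x| * `|x| <= 144.
Proof.
have Dx : `|l' th * Y x| <= `|x|.
  rewrite normrM -[leRHS]mul1r ler_pM// (ger0_norm (descent_height_ge0 x)).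
  exact: descent_height_le.
have s1 := norm_sin_le1 (phase_im x (y th x)).
have h : `|V th x| <= expR (- (x ^+ 2 / 3)) * `|x|.
  rewrite /V normrN 2!normrM ger0_norm ?expR_ge0//.
  by rewrite ler_pM// ?mulr_ge0 ?expR_ge0// -[leRHS]mulr1 ler_pM// expR_ge0.
apply: le_trans (ler_wpM2r (normr_ge0 x) h) _.
rewrite -mulrA -expr2 real_normK ?num_real//.
have g1 : gauss6 x <= 1.
  by rewrite -expR0 ler_expR oppr_le0 divr_ge0// sqr_ge0.
have := poly_gauss x; have e0 := expR_ge0 (- (x ^+ 2 / 3)).
have : x ^+ 2 <= (1 + x ^+ 2) ^+ 2.
  by have := sqr_ge0 x; have := sqr_ge0 (x ^+ 2); lra.
by move=> /(ler_wpM2l e0); lra.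
Qed.

Let V_vanish th : V th n.+1%:R - V th (- n.+1%:R) @[n --> \oo] --> 0.
Proof.
apply: norm_cvg0; apply: (@squeeze_cvgr _ _ _ _ (cst 0) (fun n => 288 * harmonic n)).
- apply: nearW => n; rewrite normr_ge0/=.
  have n0 : 0 < n.+1%:R :> R by [].
  have h s : `|s| = n.+1%:R -> `|V th s| <= 144 / n.+1%:R.
    by move=> sn; rewrite ler_pdivlMr// -sn V_le.
  rewrite (le_trans (ler_normB _ _))//.
  have h1 : `|V th n.+1%:R| <= 144 / n.+1%:R by apply: h; rewrite ger0_norm.
  have h2 : `|V th (- n.+1%:R)| <= 144 / n.+1%:R by apply: h; rewrite normrN ger0_norm.
  by rewrite (le_trans (lerD h1 h2))// /harmonic /= -mulrDl ler_wpM2r ?invr_ge0//; lra.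
- exact: cvg_cst.
- by rewrite -(mulr0 288); apply: cvgM; [exact: cvg_cst|exact: cvg_harmonic].
Qed.

Let integral_W th : (\int[mu]_x (W th x)%:E = 0)%E.
Proof.
exact: (@integral_derivative_eq0 R (V th) (W th) (der_V th) (@contW th)
  (integrable_W th) (V_vanish th)).
Qed.

(** Differentiation under the integral, dominated by [W_le], leads to the integral
    of [W], the derivative of [V], which is 0 because [V] vanishes at infinity:
    this is Cauchy's theorem for the region between two neighbouring paths. *)
Lemma der_contour_integral th : is_derive th 1 (fun s => \int[mu]_x U s x) 0.
Proof.
have I0 : [set` `]th - 1, th + 1[] th by rewrite /= in_itv/=; lra.
pose G x := 144 * (18 * t + 4) * gauss6 x.
have G0 x : 0 <= G x by rewrite !mulr_ge0 ?expR_ge0 ?addr_ge0 ?mulr_ge0 ?(ltW t0).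
have iG : mu.-integrable setT (EFin \o G).
  have := @integrableZl _ TR R mu setT measurableT (144 * (18 * t + 4)) _ integrable_gauss6.
  by apply: eq_integrable => // x _; rewrite /= -EFinM.
have iU s : [set` `]th - 1, th + 1[] s -> mu.-integrable setT (EFin \o U s).
  by move=> _; exact: integrable_contour_integrand.
have dU s x : [set` `]th - 1, th + 1[] s -> [set: TR] x -> derivable (U ^~ x) s 1.
  by move=> _ _; case: (der_U s x).
have pU s x : partial1of2 U s x = W s x by exact: derive1_der (der_U s x).
have bU s x : [set` `]th - 1, th + 1[] s -> [set: TR] x -> `|partial1of2 U s x| <= G x.
  by move=> _ _; rewrite pU; exact: W_le.
apply: DeriveDef.
  exact: (derivable_under_integral measurableT I0 iU dU G0 iG bU).
rewrite -derive1E (differentiation_under_integral measurableT I0 iU dU G0 iG bU).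
under eq_Rintegral do rewrite pU.
by rewrite /Rintegral integral_W.
Qed.

Lemma contour_deformation : \int[mu]_x U 0 x = \int[mu]_x U (pi / 2) x.
Proof. exact: is_derive_0_is_cst der_contour_integral. Qed.

End contour.

(** * Reduction to the Bessel integral *)

Section bessel.
Context {R : realType}.
Local Notation TR := (measurableTypeR R).
Local Notation mu := (@lebesgue_measure R).
Variable t : R.
Hypothesis t0 : 0 < t.
Implicit Types (x : R).

Local Notation S := (descent_radical t).
Let s : R := 2 * Num.sqrt 3 * t.
Let z : R := (108 * t ^+ 2)^-1.

Let s_gt0 : 0 < s. Proof. by rewrite !mulr_gt0// sqrtr_gt0. Qed.

Let sqr_s : s ^+ 2 = 12 * t ^+ 2.
Proof. by rewrite /s !exprMn sqr_sqrtr//; ring. Qed.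

Let decay x : R := expR (- z * (4 * S x ^+ 3 - 3 * S x)).

Lemma contour_integrand_axis x :
  contour_integrand t 0 x = expR (- (x ^+ 2 / 2)) * cos (t * x ^+ 3).
Proof.
rewrite /contour_integrand sin0 expr0n !mul0r mulr0 subr0; congr (expR _ * cos _).
  by rewrite /phase_re; field.
by rewrite /phase_im; ring.
Qed.

(** The phase is real on the path of steepest descent, and
    [x^2 = (S x ^+ 2 - 1) / (12 t^2)] makes it a polynomial in the radical. *)
Lemma contour_integrand_descent x : contour_integrand t (pi / 2) x = expR z * decay x.
Proof.
rewrite /contour_integrand sin_pihalf expr1n !mul1r.
have -> : phase_im t x (descent_height t x) = 0.
  rewrite /phase_im; have -> : t * (x ^+ 3 - 3 * x * descent_height t x ^+ 2) -
    x * descent_height t x =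
    x * (t * x ^+ 2 - (3 * t * descent_height t x ^+ 2 + descent_height t x)) by ring.
  by rewrite (descent_height_eq t0) subrr mulr0.
rewrite sin0 cos0 mul0r subr0 mulr1 /decay -expRD; congr expR.
have x2 : x ^+ 2 = (S x ^+ 2 - 1) / (12 * t ^+ 2).
  by rewrite (sqr_descent_radical t); field; rewrite gt_eqF.
by rewrite /phase_re x2 /descent_height /z; field; rewrite gt_eqF.
Qed.

(* rho x = e^(v / 3) and v = F x in the substitution s x = sinh (v / 3), for which
   S x = cosh (v / 3). *)
Let rho x : R := s * x + S x.

Let rhoV x : rho x * (S x - s * x) = 1.
Proof.
rewrite /rho; have -> : (s * x + S x) * (S x - s * x) = S x ^+ 2 - s ^+ 2 * x ^+ 2 by ring.
by rewrite (sqr_descent_radical t) sqr_s; ring.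
Qed.

Let sx_lt x : `|s * x| < S x.
Proof.
rewrite -(@ltr_sqr _ `|s * x|) ?nnegrE ?(ltW (descent_radical_gt0 t x))//.
by rewrite real_normK ?num_real// (sqr_descent_radical t) exprMn sqr_s ltrDr.
Qed.

Let rho_gt0 x : 0 < rho x.
Proof. by have := sx_lt x; rewrite ltr_norml /rho => /andP[]; lra. Qed.

Let invrho x : (rho x)^-1 = S x - s * x.
Proof. by apply: (mulfI (lt0r_neq0 (rho_gt0 x))); rewrite rhoV divff// gt_eqF. Qed.

Let F x : R := 3 * ln (rho x).

Lemma cosh_third x : cosh (3^-1 * F x) = S x.
Proof.
rewrite /cosh /F mulKf// expRN lnK ?posrE// invrho /rho; by field.
Qed.

(** The triplication formula [cosh (3 a) = 4 cosh^3 a - 3 cosh a]. *)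
Lemma cosh_F x : cosh (F x) = 4 * S x ^+ 3 - 3 * S x.
Proof.
rewrite /cosh /F expRN expRM_natl lnK ?posrE//.
rewrite -exprVn invrho (_ : rho x ^+ 3 + (S x - s * x) ^+ 3 =
  8 * S x ^+ 3 - 6 * (rho x * (S x - s * x)) * S x); last by rewrite /rho; ring.
by rewrite rhoV; field.
Qed.

Let der_rho x : is_derive x 1 rho (s * rho x / S x).
Proof.
apply: (der_eq (derD (derM (der_cst s x) (der_id x)) (der_descent_radical t x))).
by rewrite /rho -sqr_s; field; rewrite gt_eqF// descent_radical_gt0.
Qed.

Let der_F x : is_derive x 1 F (3 * s / S x).
Proof.
apply: (der_eq (derM (der_cst 3 x) (der_ln (rho_gt0 x) (der_rho x)))).
by field; rewrite !gt_eqF// descent_radical_gt0.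
Qed.

Let dF : derive1 F = fun x => 3 * s / S x.
Proof. by apply/funext => x; exact: derive1_der. Qed.

Let contS : continuous S. Proof. exact: der_continuous (der_descent_radical t). Qed.

Let cont_cst (c : R) : continuous (fun _ : R => c). Proof. exact: cst_continuous. Qed.

Let cont_dF : continuous (derive1 F).
Proof.
rewrite dF; apply: contM; first exact: cont_cst.
by apply: contV => // x; rewrite gt_eqF// descent_radical_gt0.
Qed.

Let S_cvgy : S x @[x --> +oo] --> +oo.
Proof.
apply/cvgryPge => A; near=> x.
have : A / s <= x by near: x; apply: nbhs_pinfty_ge; rewrite num_real.
rewrite ler_pdivrMr// mulrC => h; apply: (le_trans h).
by rewrite (le_trans _ (ltW (sx_lt x)))// ler_norm.
Unshelve. all: by end_near. Qed.

Let F_cvgy : F x @[x --> +oo] --> +oo.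
Proof.
apply/cvgryPge => A; near=> x.
have : expR (A / 3) / s <= x by near: x; apply: nbhs_pinfty_ge; rewrite num_real.
rewrite ler_pdivrMr// (mulrC x) => h.
rewrite /F -ler_pdivrMl// (mulrC _ A) -(expRK (A / 3)) ler_ln ?posrE ?expR_gt0//.
by rewrite (le_trans h)// /rho lerDl ltW// descent_radical_gt0.
Unshelve. all: by end_near. Qed.

Let G (v : R) : R := expR (- z * cosh v) * cosh (3^-1 * v).

Let cont_cosh : continuous (@cosh R).
Proof.
apply: contM; last exact: cont_cst.
apply: contD; first exact: continuous_expR.
apply: (cont_comp (f := expR)); first exact: continuous_expR.
by apply: contN => x; exact: cvg_id.
Qed.

Let contG : continuous G.
Proof.
apply: contM.
  apply: (cont_comp (f := expR)); first exact: continuous_expR.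
  by apply: contM; [exact: cont_cst|exact: cont_cosh].
apply: (cont_comp (f := @cosh R)) => //.
by apply: contM; [exact: cont_cst|move=> x; exact: cvg_id].
Qed.

Let cosh_ge0 (v : R) : 0 <= cosh v.
Proof. by rewrite mulr_ge0// addr_ge0// expR_ge0. Qed.

Lemma F_increasing : {homo F : x y / x < y}.
Proof.
move=> x y xy; rewrite /F ltr_pM2l// ltr_ln ?posrE// /rho -subr_lt0.
rewrite ltNge; apply/negP => h.
have d0 : 0 < s * (y - x) by rewrite mulr_gt0// subr_gt0.
have := sx_lt x; have := sx_lt y; rewrite !ltr_norml => /andP[y1 _] /andP[x1 _].
have e : (S x - S y) * (S x + S y) = - (s * (y - x) * (s * x + s * y)).
  rewrite (_ : (S x - S y) * (S x + S y) = S x ^+ 2 - S y ^+ 2); last by ring.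
  by rewrite !sqr_descent_radical -!sqr_s; ring.
have : s * (y - x) * (S x + S y) <= (S x - S y) * (S x + S y).
  by rewrite ler_wpM2r ?addr_ge0 ?(ltW (descent_radical_gt0 t _))//; move: h; lra.
rewrite e -mulrN ler_pM2l//; lra.
Qed.

Let integrable_decay : mu.-integrable setT (EFin \o decay).
Proof.
have := @integrableZl _ TR R mu setT measurableT (expR z)^-1 _
  (integrable_contour_integrand t0 (pi / 2)).
apply: eq_integrable => // x _; rewrite /= contour_integrand_descent -EFinM mulKf//.
by rewrite gt_eqF// expR_gt0.
Qed.

(** In [v = F x], the factor [S x] in [dv = 3 s dx / S x] cancels the factor
    [cosh (v / 3)] of the Bessel integrand, and [cosh v] is given by
    [cosh_F]. *)
Lemma besselK_substitution :
  besselK 3^-1 z = 3 * s * \int[mu]_(x in `[0, +oo[) decay x.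
Proof.
have F0 : F 0 = 0.
  by rewrite /F /rho /descent_radical mulr0 expr0n mulr0 addr0 sqrtr1 add0r ln1 mulr0.
have sub : (\int[mu]_(v in `[F 0, +oo[) (G v)%:E =
    \int[mu]_(x in `[0%R, +oo[) (((G \o F) * (derive1 F))%R x)%:E)%E.
  apply: increasing_ge0_integration_by_substitutiony.
  - by move=> x y _ _; exact: F_increasing.
  - by move=> x _; exact: cont_dF.
  - apply/cvg_ex; exists (derive1 F 0); apply: cvg_at_right_filter; exact: cont_dF.
  - apply/cvg_ex; exists 0; rewrite dF.
    rewrite -(mulr0 (3 * s)); apply: cvgM; first exact: cvg_cst.
    by apply/gtr0_cvgV0 => //; apply: nearW => x; exact: descent_radical_gt0.
  - split; first by move=> x _; case: (der_F x).
    apply: cvg_at_right_filter; exact: (der_continuous der_F).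
  - exact: F_cvgy.
  - exact: continuous_subspaceT.
  - by move=> v _; rewrite mulr_ge0// expR_ge0.
rewrite F0 in sub.
rewrite -RintegralZl//; last exact: integrableS integrable_decay.
rewrite /besselK /Rintegral sub; congr fine; apply: eq_integral => x _; congr EFin.
rewrite -[LHS]/(G (F x) * derive1 F x) dF /G cosh_third cosh_F /decay; field.
by rewrite gt_eqF// descent_radical_gt0.
Qed.

Lemma decay_even : \int[mu]_x decay x = 2 * \int[mu]_(x in `[0, +oo[) decay x.
Proof.
have S_even x : S (- x) = S x by rewrite /descent_radical sqrrN.
rewrite /Rintegral ge0_symfun_integralT.
- rewrite -set_itvcy fineM//; apply: integrable_fin_num => //.
  exact: integrableS integrable_decay.
- by move=> x; exact: expR_ge0.
- apply: (cont_comp (f := expR)); first exact: continuous_expR.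
  apply: contM; first exact: cont_cst.
  apply: contD; last first.
    by apply: contN; apply: contM; [exact: cont_cst|exact: contS].
  apply: contM; first exact: cont_cst.
  by do 2![apply: contM => //].
- by move=> x; rewrite /decay /= S_even.
Qed.

(** The integral over the axis is the one over the path of steepest descent, whose
    integrand is even in [x]: it is twice a Bessel integral. *)
Theorem cubic_gauss_integral :
  \int[mu]_x (expR (- (x ^+ 2 / 2)) * cos (t * x ^+ 3)) =
  (3 * Num.sqrt 3 * t)^-1 * expR z * besselK 3^-1 z.
Proof.
transitivity (\int[mu]_x contour_integrand t 0 x).
  by apply: eq_Rintegral => x _; rewrite contour_integrand_axis.
rewrite (contour_deformation t0); under eq_Rintegral do rewrite contour_integrand_descent.
rewrite RintegralZl// decay_even besselK_substitution /s.
have s30 : Num.sqrt 3 != 0 :> R by rewrite gt_eqF// sqrtr_gt0.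
by field; rewrite s30 gt_eqF.
Qed.

End bessel.

(** * The characteristic function of the cube of a Gaussian variable *)

Section gaussian_characteristic.
Context {R : realType}.
Local Notation C := R[i].
Local Notation TR := (measurableTypeR R).
Local Notation mu := (@lebesgue_measure R).

Lemma odd_integral_eq0 (f : TR -> R) : mu.-integrable setT (EFin \o f) ->
  (forall x, f (- x) = - f x) -> \int[mu]_x f x = 0.
Proof.
move=> fi odd; have mf : measurable_fun [set: TR] (EFin \o f) := measurable_int mu fi.
have mN : measurable_fun [set: TR] (-%R : TR -> TR) by exact: measurable_funN.
have mE (S : set TR) : measurable S -> S `<=` setT -> mu S =
    measure_function_pushforward__canonical__measure_function_Measure mu mN S.
  by move=> mS _; rewrite /= lebesgue_measureN.
have fNi : mu.-integrable setT (EFin \o (f \o -%R)).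
  have := integrableN fi; apply: eq_integrable => // x _ /=.
  by rewrite odd.
have h : \int[mu]_x f x = \int[mu]_x (- f x).
  rewrite {1}/Rintegral (eq_measure_integral _ mE).
  have -> := @integral_pushforward _ _ TR TR R _ mN mu setT (EFin \o f) mf fNi measurableT.
  by rewrite preimage_setT; congr fine; apply: eq_integral => x _ /=; rewrite odd.
have : \int[mu]_x (- f x) = - \int[mu]_x f x.
  under eq_Rintegral do rewrite -mulN1r.
  by rewrite RintegralZl// mulN1r.
rewrite -h; move: (Rintegral _ _ _) => I {h} h; lra.
Qed.

Lemma normal_pdf01 (x : R) :
  normal_pdf 0 1 x = (Num.sqrt (2 * pi))^-1 * expR (- (x ^+ 2 / 2)).
Proof.
rewrite normal_pdfE ?oner_neq0// /normal_peak /normal_fun subr0 expr1n mul1r.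
by rewrite mulNr -mulr_natl.
Qed.

Lemma cintegral_normal (h : R -> C) : cmeasurable h ->
  cintegral (normal_prob 0 1) h =
  cintegral mu (fun x => h x * (normal_pdf 0 1 x)%:C).
Proof.
have ipdf : (\int[mu]_x (normal_pdf 0 1 x)%:E < +oo)%E by rewrite integral_normal_pdf ltry.
move=> mh; apply: (cintegral_law (phi := id) _ (@normal_pdf_ge0 R 0 1) ipdf) => //.
exact: measurable_normal_pdf.
Qed.

Lemma cos_abs (t y : R) : cos (`|t| * y) = cos (t * y).
Proof. by have [_|_] := ger0P t; rewrite // mulNr cosN. Qed.

Lemma integrable_damped_cos (g : TR -> R) : measurable_fun setT g ->
  mu.-integrable setT (EFin \o (fun x => expR (- (x ^+ 2 / 2)) * cos (g x))).
Proof.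
move=> mg; have c0 : 0 < Num.sqrt (2 * pi) :> R.
  by rewrite sqrtr_gt0 mulr_gt0// pi_gt0.
have i := @integrableZl _ TR R mu setT measurableT (Num.sqrt (2 * pi)) _
  (@integrable_normal_pdf R 0 1).
apply: le_integrable i => //.
  apply/measurable_EFinP; apply: measurable_funM; last first.
    by apply: (measurableT_comp _ mg); apply: continuous_measurable_fun; exact: continuous_cos.
  apply: (measurableT_comp (@measurable_expR R)); apply: measurableT_comp => //.
  by apply: measurable_funM => //; exact: measurable_funX.
move=> x _ /=; rewrite lee_fin normal_pdf01 mulVKf ?gt_eqF// normrM.
rewrite -[leRHS]mulr1 ler_wpM2l// ler_norml cos_geN1; exact: cos_le1.
Qed.

(** The imaginary part is the integral of an odd function; in the real part the
    sign of [t] disappears because [cos] is even. *)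
Lemma cintegral_normal_cube (t : R) :
  cintegral (normal_prob 0 1) (fun x => expi (t * x ^+ 3)) =
  ((Num.sqrt (2 * pi))^-1 *
     \int[mu]_x (expR (- (x ^+ 2 / 2)) * cos (`|t| * x ^+ 3)))%:C.
Proof.
have mc : measurable_fun [set: TR] (fun x : TR => t * x ^+ 3).
  by apply: measurable_funM => //; exact: measurable_funX.
have me : cmeasurable (fun x : R => expi (t * x ^+ 3)) by exact: cmeasurable_expi.
rewrite cintegral_normal//; apply: complexP => /=.
  rewrite /cintegral /= -RintegralZl//; last first.
    by apply: integrable_damped_cos; apply: measurable_funM => //; exact: measurable_funX.
  congr fine; apply: eq_integral => x _ /=; congr EFin.
  rewrite ?mulr0 ?subr0 normal_pdf01 cos_abs; ring.
rewrite /cintegral /=; under eq_integral do rewrite /= mulr0 add0r.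
apply: odd_integral_eq0 => [|x].
  apply: le_integrable (integrable_normal_pdf 0 1) => //.
    apply/measurable_EFinP; apply: measurable_funM; last exact: measurable_normal_pdf.
    by case: me.
  move=> x _ /=; rewrite lee_fin normrM -[leRHS]mul1r ler_wpM2r//.
  by rewrite ler_norml sin_geN1 sin_le1.
rewrite !normal_pdf01 sqrrN exprNn -signr_odd /= expr1 mulN1r mulrN sinN; ring.
Qed.

End gaussian_characteristic.

Local Close Scope classical_set_scope.

Theorem corollary2p4 (R : realType) :
  has_law (Phi R) (opT R) (normal_prob 0 1) /\
  forall t : R,
    char_fun (Phi R) (op_cube (opT R)) t =
      (if t != 0 then
         (3 * `|t| * Num.sqrt (6 * pi))^-1 * expR (108 * t ^+ 2)^-1
         * besselK (3^-1) (108 * t ^+ 2)^-1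
       else 1)%:C.
Proof.
split=> t; first exact: char_fun_T.
rewrite char_fun_T3 cintegral_normal_cube; congr (_%:C).
case: ifPn => [t0|]; last first.
  rewrite negbK => /eqP ->; rewrite normr0.
  have p0 : 0 < Num.sqrt (2 * pi) :> R by rewrite sqrtr_gt0 mulr_gt0// pi_gt0.
  rewrite -RintegralZl//; last first.
    by apply: (integrable_damped_cos (g := fun x => 0 * x ^+ 3)); exact: measurable_funM.
  rewrite -[RHS]/(fine 1%:E) -(@integral_normal_pdf R 0 1); congr fine.
  by apply: eq_integral => x _; rewrite mul0r cos0 mulr1 normal_pdf01.
have nt0 : 0 < `|t| by rewrite normr_gt0.
rewrite (cubic_gauss_integral nt0) real_normK ?num_real// !mulrA; congr (_ * _ * _).
rewrite -invfM; congr (_^-1).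
have -> : 6 * pi = 3 * (2 * pi) :> R by ring.
rewrite (sqrtrM (2 * pi))//; ring.
Qed.
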